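(* Each distribution of an infinite exchangeable partition of $\mathbb N$ (which can be identified with a partition structure) corresponds to at most one (in distribution) regenerative composition structure. Equivalently, for each distribution of a decreasing sequence $(Y_j)$ with $Y_j\ge0$ and $\sum_jY_j\le1$, there exists at most one distribution for a multiplicatively regenerative set $\widetilde{\mathcal R}\subset[0,1]$ such that the ranked lengths of the interval components of $\widetilde{\mathcal R}^c=[0,1]\setminus\widetilde{\mathcal R}$ are distributed like $(Y_j)$.
   Context: A composition of $n$ is a sequence of positive integers (its parts) with sum $n$. A composition structure $(\mathcal C_n)_{n\ge1}$ is a Markovian sequence of random compositions $\mathcal C_n$ of $n$ such that, if $n$ identical balls are distributed into an ordered series of boxes according to $\mathcal C_n$, then $\mathcal C_{n-1}$ is obtained by discarding one of the balls picked uniformly at random and then deleting an empty box in case one is created. It is regenerative if for all $n>m\ge1$, given that the first part of $\mathcal C_n$ is $m$, the remaining composition of $n-m$ is distributed like $\mathcal C_{n-m}$. Associated exchangeable partition: labelling the $n$ balls in the boxes of $\mathcal C_n$ by an independent uniform random permutation of $[n]$ and ignoring the order of boxes gives a random exchangeable partition $\Pi_n$ of $[n]$; these can be constructed consistently in $n$ and define an exchangeable partition $\Pi$ of $\mathbb N$. A distribution of $\Pi$ corresponds to $(\mathcal C_n)$ if it is obtained in this way. The associated partition structure is the sequence of random partitions of $n$ given by the decreasing rearrangements of the parts of $\mathcal C_n$. Closed subsets of $[0,1]$ are always assumed to contain $0$ and $1$. For closed $R\subset[0,1]$ and $z\in[0,1[$ let $D(R,z)=\inf(R\cap\,]z,1])$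 and, if $D(R,z)<1$, $R(z)=\{(y-D(R,z))/(1-D(R,z)):y\in R\cap[D(R,z),1]\}$. A random closed set $\widetilde{\mathcal R}\subset[0,1]$ is multiplicatively regenerative if for each $z\in[0,1[$, conditionally on $\{D(\widetilde{\mathcal R},z)<1\}$, $\widetilde{\mathcal R}(z)$ is independent of $[0,D(\widetilde{\mathcal R},z)]\cap\widetilde{\mathcal R}$ and has the same distribution as $\widetilde{\mathcal R}$. Ranked lengths means the decreasing rearrangement of the lengths, padded by zeros if there are only finitely many components. *)

(* Defs.v *)
From HB Require Import structures.
From mathcomp Require Import all_boot all_order all_algebra all_fingroup.
From mathcomp Require Import all_classical all_reals all_analysis.
Set Implicit Arguments.
Unset Strict Implicit.
Unset Printing Implicit Defensive.
Import Order.TTheory GRing.Theory Num.Theory.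
Import numFieldNormedType.Exports.
Local Open Scope classical_set_scope.
Local Open Scope ring_scope.

(* Conditional probability of A given E; only used when P E != 0. *)
Definition condprob d (T : measurableType d) (R : realType)
    (P : probability T R) (A E : set T) : R :=
  fine (P (A `&` E)) / fine (P E).

Definition same_law d1 d2 d (T1 : measurableType d1) (T2 : measurableType d2)
    (E : measurableType d) (R : realType)
    (P1 : probability T1 R) (X1 : {RV P1 >-> E})
    (P2 : probability T2 R) (X2 : {RV P2 >-> E}) : Prop :=
  forall B : set E, measurable B ->
    distribution P1 X1 B = distribution P2 X2 B.

(** Composition structures *)

HB.instance Definition _ (T : choiceType) := isPointed.Build (seq T) [::].

(* A composition of n; the only composition of 0 is the empty sequence. *)
Definition is_composition (n : nat) (c : seq nat) : bool :=
  all (fun m => 0 < m)%N c && (sumn c == n).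

(* Sequences (c_n) of compositions, with the product of the discrete
   sigma-algebras on seq nat. The term of index 0 is a dummy: in the random
   sequences below it is always the empty composition of 0. *)
Definition comp_cylinders : set (set (nat -> seq nat)) :=
  [set B | exists n s, B = [set c | c n = s]].

Notation comp_seqs := (g_sigma_algebraType comp_cylinders).

(* The balls of a composition c of n are 0, ..., n-1, numbered in the order of
   the boxes: reshape_index c k is the index of the box containing ball k. *)
Definition discard (c : seq nat) (k : nat) : seq nat :=
  let b := reshape_index c k in
  [seq m <- set_nth 0%N c b (nth 0%N c b).-1 | (0 < m)%N].

Definition composition_structure d (T : measurableType d) (R : realType)
    (P : probability T R) (C : {RV P >-> comp_seqs}) : Prop :=
  [/\ forall w n, is_composition n (C w n),
      forall (n : nat) (c : nat -> seq nat), (0 < n)%N ->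
        let past := [set w | forall k, (0 < k <= n)%N -> C w k = c k] in
        let next := [set w | C w n.+1 = c n.+1] in
        P past != 0%E ->
        condprob P next past = condprob P next [set w | C w n = c n]
    & forall (n : nat) (c c' : seq nat), (1 < n)%N ->
        P [set w | C w n = c] != 0%E ->
        condprob P [set w | C w n.-1 = c'] [set w | C w n = c] =
        #|[pred k : 'I_n | discard c k == c']|%:R / n%:R].

Definition regenerative_structure d (T : measurableType d) (R : realType)
    (P : probability T R) (C : {RV P >-> comp_seqs}) : Prop :=
  forall (n m : nat) (s : seq nat), (0 < m < n)%N ->
    let first := [set w | head 0%N (C w n) = m] in
    P first != 0%E ->
    condprob P [set w | behead (C w n) = s] first =
    fine (P [set w | C w (n - m)%N = s]).

Definition regenerative_composition_structure d (T : measurableType d)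
    (R : realType) (P : probability T R) (C : {RV P >-> comp_seqs}) : Prop :=
  composition_structure C /\ regenerative_structure C.

Definition same_partition_structure d1 d2 (T1 : measurableType d1)
    (T2 : measurableType d2) (R : realType)
    (P1 : probability T1 R) (C1 : {RV P1 >-> comp_seqs})
    (P2 : probability T2 R) (C2 : {RV P2 >-> comp_seqs}) : Prop :=
  forall (n : nat) (s : seq nat), (0 < n)%N ->
    P1 [set w | sort geq (C1 w n) = s] = P2 [set w | sort geq (C2 w n) = s].

(** Exchangeable partitions of N *)

(* A partition of N (with elements numbered from 0) is encoded by the
   equivalence relation "being in the same block"; its restriction to [n] is the
   induced relation on 'I_n. *)
Definition partition_cylinders : set (set (nat -> nat -> bool)) :=
  [set B | exists i j, B = [set p : nat -> nat -> bool | p i j]].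

Notation partitions := (g_sigma_algebraType partition_cylinders).

Definition exchangeable_partition d (T : measurableType d) (R : realType)
    (P : probability T R) (Pi : {RV P >-> partitions}) : Prop :=
  (forall w, equivalence_rel (Pi w : rel nat)) /\
  forall (n : nat) (s : 'S_n) (rho : rel 'I_n),
    P [set w | forall i j : 'I_n, Pi w (s i) (s j) = rho i j] =
    P [set w | forall i j : 'I_n, Pi w i j = rho i j].

(* s i is the ball that receives the label i. *)
Definition labelled_partition (n : nat) (c : seq nat) (s : 'S_n) : rel 'I_n :=
  fun i j => reshape_index c (s i) == reshape_index c (s j).

(* For every n, Pi restricted to [n] has the law of the partition obtained by
   labelling the balls of C_n by an independent uniform permutation. *)
Definition corresponds d1 d2 (T1 : measurableType d1) (T2 : measurableType d2)
    (R : realType) (P1 : probability T1 R) (Pi : {RV P1 >-> partitions})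
    (P2 : probability T2 R) (C : {RV P2 >-> comp_seqs}) : Prop :=
  forall (n : nat) (rho : rel 'I_n), (0 < n)%N ->
    fine (P1 [set w | forall i j : 'I_n, Pi w i j = rho i j]) =
    (\sum_(s : 'S_n) fine (P2 [set w | forall i j : 'I_n,
        labelled_partition (C w n) s i j = rho i j])) / n`!%:R.

(** Random closed subsets of [0,1] *)

(* The Effros sigma-algebra, generated by the events "A hits the open set G".
   It is put on all subsets of R; random sets below take closed values. *)
Definition hitting_sets (R : realType) : set (set (set R)) :=
  [set B | exists2 G : set R, open G & B = [set A | A `&` G !=set0]].

Notation hit_sets R := (g_sigma_algebraType (@hitting_sets R)).

Definition is_closed01 (R : realType) (A : set R) : Prop :=
  [/\ closed A, A `<=` `[0, 1], A 0 & A 1].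

Definition Dpoint (R : realType) (A : set R) (z : R) : R := inf (A `&` `]z, 1]).

Definition rescaled (R : realType) (A : set R) (z : R) : set R :=
  let D := Dpoint A z in [set (y - D) / (1 - D) | y in A `&` `[D, 1]].

Definition multiplicatively_regenerative d (T : measurableType d)
    (R : realType) (P : probability T R) (X : {RV P >-> hit_sets R}) : Prop :=
  (forall w, is_closed01 (X w)) /\
  forall z : R, 0 <= z < 1 ->
    let E := [set w | Dpoint (X w) z < 1] in
    let future (B : set (hit_sets R)) := [set w | B (rescaled (X w) z)] in
    let past (B : set (hit_sets R)) :=
      [set w | B (`[0, Dpoint (X w) z] `&` X w)] in
    P E != 0%E ->
    (forall A B : set (hit_sets R), measurable A -> measurable B ->
       condprob P (future A `&` past B) E =
       condprob P (future A) E * condprob P (past B) E) /\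
    (forall A : set (hit_sets R), measurable A ->
       condprob P (future A) E = fine (distribution P X A)).

(** Ranked lengths *)

Definition real_cylinders (R : realType) : set (set (nat -> R)) :=
  [set B | exists j (U : set R), measurable U /\ B = [set y | U (y j)]].

Notation real_seqs R := (g_sigma_algebraType (@real_cylinders R)).

Definition complement_components (R : realType) (A : set R) : set (set R) :=
  [set connected_component (`[0, 1] `\` A) x | x in `[0, 1] `\` A].

(* y is the decreasing rearrangement of the lengths of the components of
   [0,1] \ A, padded by zeros: f numbers the components by the indices of the
   positive terms of y. *)
Definition is_ranked_lengths (R : realType) (A : set R) (y : nat -> R) : Prop :=
  [/\ forall j, 0 <= y j,
      forall i j, (i <= j)%N -> y j <= y i
    & exists2 f : set R -> nat,
        set_bij (complement_components A) [set j | 0 < y j] f &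
        forall I, complement_components A I ->
          y (f I) = fine (lebesgue_measure I)].

Definition ranked_lengths_distributed_like d1 d2 (T1 : measurableType d1)
    (T2 : measurableType d2) (R : realType)
    (P1 : probability T1 R) (X : {RV P1 >-> hit_sets R})
    (P2 : probability T2 R) (Y : {RV P2 >-> real_seqs R}) : Prop :=
  exists2 L : {RV P1 >-> real_seqs R},
    (forall w, is_ranked_lengths (X w) (L w)) & same_law L Y.

(* Main.v *)
(* A regenerative composition structure is determined by its decrement matrix
   q(n, m) = P(the first part of C_n is m). Sampling consistency is a linear
   recursion for q, and an alternating sum of this recursion shows that it has
   at most one solution with a given diagonal; q(n, n) is the probability that
   the partition of [n] has a single block.

   For a multiplicatively regenerative set X with D_u = D(X, u), regeneration at
   v, integrated over v in [0, 1], gives the same recursion for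
     q(n, m) = m 'C(n, m) E int_0^1 (D_u - u)^(m-1) (1 - D_u)^(n-m) du,
   and q(n, n) = E sum_j Y_j^n for n >= 2. So the law of the ranked lengths
   determines all mixed moments of 1 - u and 1 - D_u, hence P(D_u > y) for almost
   every u, and for every u by monotonicity and right continuity in u. By
   regeneration the laws of the D_u determine those of the vectors
   (D_u1, ..., D_uk), hence the law of X. *)

Require Import Defs.
From HB Require Import structures.
From mathcomp Require Import all_boot all_order all_algebra all_fingroup.
From mathcomp Require Import all_classical all_reals all_analysis.
From mathcomp Require Import measurable_realfun.
From mathcomp Require Import ring lra zify.
Import Order.TTheory GRing.Theory Num.Theory.
Import numFieldNormedType.Exports.
Local Open Scope classical_set_scope.
Local Open Scope ring_scope.
Set Implicit Arguments.
Unset Strict Implicit.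
Unset Printing Implicit Defensive.

(** * Decrement matrices *)

(** The statements about compositions and about sets share only the uniqueness of decrement
    matrices; neither is deduced from the other. Uniqueness passes from row n to row n + 1. The
    difference d of two candidates for row n + 1 solves a linear recursion with source term d(1)
    q(n, m), and the given diagonal makes d(n + 1) = 0. The alternating sum yields d(1) S = 0, where
    S is the sum of q(n, m) (1 - (-1)^m / 'C(n, m)) over 0 < m <= n. These coefficients are
    nonnegative and vanish only at m = n even. The obstacle is therefore n even with q(n, n) = 1,
    where the nonnegativity of the entries replaces the linear argument.

    For sets, the recursion comes from 1 = (D_u - u) + (1 - D_u) + u. The first two summands raise
    an exponent; the third, written as an integral over v <= u, brings in D_v. Regeneration is a
    conditional statement at each deterministic v. It is first turned into a product law on the
    event D_v < 1, and only then can Tonelli integrate over v. The event D_v = 1 contributes nothing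
    beyond the gap of v, since a positive power of 1 - D_v vanishes there. *)

Lemma sum_nat_eq0 (R : numDomainType) (F : nat -> R) (a b : nat) :
  (forall i, (a <= i < b)%N -> 0 <= F i) -> \sum_(a <= i < b) F i = 0 ->
  forall i, (a <= i < b)%N -> F i = 0.
Proof.
move=> F0 /eqP; rewrite big_seq psumr_eq0; last first.
  by move=> i; rewrite mem_index_iota => /F0.
move=> /allP H i Hi; have Hi' : i \in index_iota a b by rewrite mem_index_iota.
by have := H i Hi'; rewrite Hi' => /eqP.
Qed.

Lemma bin_gt1 (n m : nat) : (0 < m < n)%N -> (1 < 'C(n, m))%N.
Proof.
case: m n => [|m] [|n] //= mn.
by rewrite binS -addn1 leq_add // bin_gt0; lia.
Qed.

Section Decrement.
Variable R : realFieldType.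
Implicit Type q : nat -> nat -> R.

Definition decrement_matrix q :=
  [/\ forall n m, 0 <= q n m,
      forall n, (0 < n)%N -> \sum_(1 <= m < n.+1) q n m = 1
    & forall n m, (0 < m <= n)%N ->
      n.+1%:R * q n m = m.+1%:R * q n.+1 m.+1 + (n.+1 - m)%:R * q n.+1 m
                        + q n.+1 1%N * q n m].

(* Applied to [S m = d m / 'C(n.+1, m)], where [d] is the difference of two
   solutions of the recursion at [n.+1] which agree at [n]. *)
Lemma alternating_telescope (S c : nat -> R) (n : nat) :
  (forall m, (0 < m <= n)%N -> S m + S m.+1 = c m) ->
  \sum_(1 <= m < n.+1) (-1) ^+ m * c m = - S 1%N + (-1) ^+ n * S n.+1.
Proof.
elim: n => [|n IH] H; first by rewrite big_nil expr0; lra.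
rewrite big_nat_recr //= IH; last by move=> m Hm; apply: H; lia.
by rewrite -H ?leqnn// exprS; ring.
Qed.

(** Row [n] sits entirely at [m = n], so for [m < n] the left side of the recursion is 0 and the
    nonnegative terms on the right vanish one by one. As [1 < n], the indices [m] and [m.+1] with
    [0 < m < n] together cover [1, ..., n]. *)
Lemma decrement_degenerate q (n : nat) : decrement_matrix q -> (1 < n)%N ->
  q n n = 1 -> forall m, (0 < m <= n)%N -> q n.+1 m = 0.
Proof.
move=> [q0 q1 qrec] n1 qnn.
have qz m : (0 < m < n)%N -> q n m = 0.
  move=> Hm; have := q1 n ltac:(lia).
  rewrite big_nat_recr ?(ltnW n1) //= qnn => /(canRL (addrK _)); rewrite subrr.
  by move/sum_nat_eq0; apply.
have qz1 m : (0 < m < n)%N -> q n.+1 m = 0 /\ q n.+1 m.+1 = 0.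
  move=> Hm; have := qrec n m ltac:(lia); rewrite qz // !mulr0 addr0.
  move/esym/eqP; rewrite paddr_eq0 ?mulr_ge0 // !mulf_eq0 !pnatr_eq0.
  rewrite (_ : (n.+1 - m == 0)%N = false) /=; last by lia.
  by move=> /andP[/eqP -> /eqP ->].
move=> m Hm; have [->|mn] := eqVneq m 1%N; first by have [] := qz1 1%N n1.
by have [_] := qz1 m.-1 ltac:(lia); rewrite prednK //; lia.
Qed.

Lemma decrement_step q q' (n : nat) : decrement_matrix q -> decrement_matrix q' ->
  (0 < n)%N -> q n.+1 n.+1 = q' n.+1 n.+1 ->
  (forall m, (0 < m <= n)%N -> q n m = q' n m) ->
  forall m, (0 < m <= n.+1)%N -> q n.+1 m = q' n.+1 m.
Proof.
move=> dq dq' n0 qN qn; pose d m := q n.+1 m - q' n.+1 m.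
have [[q0 q1 qrec] [q0' q1' qrec']] := (dq, dq').
have dN : d n.+1 = 0 by rewrite /d qN subrr.
have drec m : (0 < m <= n)%N ->
   m.+1%:R * d m.+1 + (n.+1 - m)%:R * d m = - (d 1%N * q n m).
  move=> Hm; have := qrec n m Hm; have := qrec' n m Hm.
  by rewrite -qn // /d; lra.
(* With [d 1 = 0] the recursion is homogeneous and runs downwards from [d n.+1 = 0], the coefficient
   [n.+1 - m] of [d m] being nonzero. *)
suff d1 : d 1%N = 0.
  have dz k : (k <= n)%N -> d (n.+1 - k)%N = 0.
    elim: k => [|k IH] kn; first by rewrite subn0.
    have := drec (n.+1 - k.+1)%N ltac:(lia).
    rewrite (_ : (n.+1 - k.+1).+1 = n.+1 - k)%N ?IH ?d1; try lia.
    rewrite mulr0 mul0r oppr0 add0r => /eqP; rewrite mulf_eq0 pnatr_eq0.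
    by case/orP => [|/eqP //]; lia.
  move=> m Hm; apply/eqP; rewrite -subr_eq0; apply/eqP.
  by have := dz (n.+1 - m)%N ltac:(lia); rewrite subKn //; lia.
(* The only case in which the factor of [d 1] in [tauE] can vanish. *)
have [/andP[on /eqP qnn]|nondeg] := boolP (~~ odd n && (q n n == 1)).
  have n1 : (1 < n)%N by case: n n0 on {qN qn qnn dN drec d} => [|[]].
  rewrite /d !(@decrement_degenerate _ n) ?subrr //.
  by rewrite -qn // n0 /=.
(* Dividing by the binomial equalizes the two coefficients of the recursion: [n.+1 * 'C(n, m)] is
   both [m.+1 * 'C(n.+1, m.+1)] and [(n.+1 - m) * 'C(n.+1, m)]. *)
pose S m := d m / 'C(n.+1, m)%:R; pose c m := - (d 1%N * q n m) / (n.+1 * 'C(n, m))%:R.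
have Cn0 k m : (m <= k)%N -> 'C(k, m)%:R != 0 :> R by move=> ?; rewrite pnatr_eq0 -lt0n bin_gt0.
have Sc m : (0 < m <= n)%N -> S m + S m.+1 = c m.
  move=> /andP[m0 mn]; rewrite /S /c -drec ?m0 //.
  have E1 : (n.+1 * 'C(n, m) = m.+1 * 'C(n.+1, m.+1))%N by rewrite mul_bin_diag.
  have E2 : (n.+1 * 'C(n, m) = (n.+1 - m) * 'C(n.+1, m))%N by rewrite mul_bin_down.
  rewrite [RHS]mulrDl {1}E1 E2 !natrM.
  have H1 : (n.+1 - m)%:R != 0 :> R by rewrite pnatr_eq0; lia.
  have H2 : m.+1%:R != 0 :> R by rewrite pnatr_eq0.
  have := Cn0 n.+1 m ltac:(lia); have := Cn0 n.+1 m.+1 ltac:(lia).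
  move=> x0 y0; have M (k a b : R) : k != 0 -> k * a / (k * b) = a / b.
    by move=> k0; rewrite -mulf_div divff // mul1r.
  by rewrite !M // addrC.
have := alternating_telescope Sc.
rewrite /S dN mul0r mulr0 addr0 bin1 => Halt.
have tauE : d 1%N * (1 + \sum_(1 <= m < n.+1) - (-1) ^+ m * (q n m / 'C(n, m)%:R)) = 0.
  have -> : d 1%N * (1 + \sum_(1 <= m < n.+1) - (-1) ^+ m * (q n m / 'C(n, m)%:R)) =
     d 1%N + n.+1%:R * \sum_(1 <= m < n.+1) (-1) ^+ m * c m.
    rewrite mulrDr mulr1 !mulr_sumr; congr (_ + _); apply: eq_big_nat => m Hm.
    rewrite /c natrM; have := Cn0 n m ltac:(lia).
    move: (('C(n, m))%:R : R) ((-1 : R) ^+ m) => x y x0.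
    by field; rewrite x0 addrC natr1 pnatr_eq0.
  by rewrite Halt; field; rewrite addrC natr1 pnatr_eq0.
move/eqP: tauE; rewrite mulf_eq0 => /orP[/eqP //|/eqP sum0]; exfalso.
(* The 1 in the factor is spread over the row as the sum of the [q n m]; the resulting terms are
   nonnegative, so each of them is 0. *)
have termge m : (0 < m <= n)%N -> 0 <= q n m + - (-1) ^+ m * (q n m / 'C(n, m)%:R).
  move=> Hm; have C1 : 1 <= 'C(n, m)%:R :> R by rewrite ler1n bin_gt0; lia.
  have : q n m / 'C(n, m)%:R <= q n m.
    by rewrite ler_pdivrMr ?(lt_le_trans ltr01) // ler_peMr.
  have : 0 <= q n m / 'C(n, m)%:R by rewrite divr_ge0.
  by rewrite -signr_odd; case: odd; rewrite ?expr1 ?expr0; lra.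
have tot : \sum_(1 <= m < n.+1) (q n m + - (-1) ^+ m * (q n m / 'C(n, m)%:R)) = 0.
  by rewrite big_split /= q1.
have tz m : (0 < m <= n)%N -> q n m + - (-1) ^+ m * (q n m / 'C(n, m)%:R) = 0.
  by move=> Hm; apply: sum_nat_eq0 tot _ _.
(* Here the binomial exceeds 1, so a vanishing term forces [q n m = 0]. All mass is then at [m = n],
   which leaves odd [n], where the last term equals 2. *)
have qz m : (0 < m < n)%N -> q n m = 0.
  move=> Hm; have := tz m ltac:(lia).
  have C1 : 1 < 'C(n, m)%:R :> R.
    by rewrite ltr1n bin_gt1.
  have C0 : 0 < 'C(n, m)%:R :> R by lra.
  have := q0 n m; rewrite le_eqVlt => /orP[/eqP //|qpos].
  have : q n m / 'C(n, m)%:R < q n m by rewrite ltr_pdivrMr // ltr_pMr.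
  have : 0 < q n m / 'C(n, m)%:R by rewrite divr_gt0.
  by rewrite -signr_odd; case: odd; rewrite ?expr1 ?expr0; lra.
have qnn : q n n = 1.
  by have := q1 n n0; rewrite big_nat_recr //= big_nat big1 ?add0r //.
move: nondeg; rewrite qnn eqxx andbT negbK => on.
have := tz n ltac:(lia).
by rewrite qnn binn invr1 -signr_odd on expr1; lra.
Qed.

Lemma decrement_unique q q' : decrement_matrix q -> decrement_matrix q' ->
  (forall n, (1 < n)%N -> q n n = q' n n) ->
  forall n m, (0 < m <= n)%N -> q n m = q' n m.
Proof.
move=> dq dq' qq' n; elim: n => [|[|n] IH] m Hm; first by lia.
  have [[_ q1 _] [_ q1' _]] := (dq, dq').
  have -> : m = 1%N by lia.
  by have := q1 1%N isT; have := q1' 1%N isT; rewrite !big_nat1 => -> ->.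
by apply: (decrement_step dq dq') Hm => //; apply: qq'.
Qed.
End Decrement.

(** * Compositions *)

(** [n] bounds both the length and the parts, so compositions of larger numbers occur as well;
    [compositions] filters them out. *)
Fixpoint compositions_upto (n : nat) : seq (seq nat) :=
  if n is n'.+1 then [::] :: [seq m :: c | m <- iota 1 n, c <- compositions_upto n']
  else [:: [::]].

Lemma mem_compositions_upto n c :
  all (fun m => 0 < m)%N c -> (sumn c <= n)%N -> c \in compositions_upto n.
Proof.
elim: n c => [|n IH] [|m c] // => /andP[m0 c0]; rewrite [sumn _]/= => mc.
  by lia.
rewrite inE; apply/orP; right; apply: (allpairs_f cons).
  by rewrite mem_iota; lia.
by apply: IH => //; lia.
Qed.

Definition compositions n := undup [seq c <- compositions_upto n | is_composition n c].

Lemma mem_compositions n c : (c \in compositions n) = is_composition n c.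
Proof.
rewrite mem_undup mem_filter andb_idr // => /andP[c0 /eqP cn].
by rewrite mem_compositions_upto // cn.
Qed.

Lemma compositions_uniq n : uniq (compositions n). Proof. exact: undup_uniq. Qed.

Lemma is_composition_cons n m c :
  is_composition n (m :: c) = (0 < m <= n)%N && is_composition (n - m) c.
Proof.
rewrite /is_composition /=; case: all; rewrite ?andbF ?andbT //=.
by case: m => //= m; lia.
Qed.

Lemma reshape_index_cons a c k :
  reshape_index (a :: c) k = if (k < a)%N then 0%N else (reshape_index c (k - a)).+1.
Proof.
rewrite /reshape_index /= subn_eq0; case: ltnP => // ak.
by rewrite subSn.
Qed.

Lemma discard_cons a c k : (0 < a)%N -> all (fun m => 0 < m)%N c ->
  discard (a :: c) k =
  if (k < a)%N then (if a == 1%N then c else a.-1 :: c) else a :: discard c (k - a).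
Proof.
move=> a0 c0; rewrite /discard reshape_index_cons; case: ltnP => /= ak.
  have -> : [seq m <- c | (0 < m)%N] = c by apply/all_filterP.
  by case: a a0 {ak} => [//|[|a]].
by rewrite a0.
Qed.

Lemma discard_composition n c k : is_composition n.+1 c -> (k <= n)%N ->
  is_composition n (discard c k).
Proof.
elim: c n k => [//|a c IH] n k.
rewrite is_composition_cons => /andP[/andP[a0 an] cc] kn.
rewrite discard_cons //; last by case/andP: cc.
case: ltnP => ka.
  case: eqP => [a1|]; first by move: cc; rewrite a1 subSS subn0.
  by rewrite is_composition_cons => ?; apply/andP; split; [lia|move: cc; congr is_composition; lia].
rewrite is_composition_cons a0 (leq_trans ka kn) /=.
by apply: IH; [move: cc; congr is_composition|]; lia.
Qed.

(** A removal leaves first part [m] in three ways: it takes a ball of a first box of size [m.+1], or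
    a ball outside a first box of size [m], or the only ball of the first box when the second box
    has size [m]. *)
Lemma sum_head_discard (n m : nat) c : is_composition n.+1 c -> (0 < n)%N -> (0 < m)%N ->
  (\sum_(k < n.+1) (head 0%N (discard c k) == m) =
   m.+1 * (head 0%N c == m.+1) + (n.+1 - m) * (head 0%N c == m)
   + ((head 0%N c == 1%N) && (head 0%N (behead c) == m)))%N.
Proof.
case: c => [//|a c]; rewrite is_composition_cons => /andP[/andP[a0 an] cc] n0 m0.
rewrite -(big_mkord xpredT (fun k => (head 0%N (discard (a :: c) k) == m) : nat)).
rewrite (big_cat_nat (n := a)) //=.
have c0 : all (fun m => 0 < m)%N c by case/andP: cc.
rewrite (eq_big_nat _ _ (F2 := fun=> nat_of_bool (if a == 1%N then head 0%N c == m else a.-1 == m))); last first.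
  by move=> k /andP[_ ka]; rewrite discard_cons // ka; case: (a == 1%N).
rewrite [X in (_ + X)%N](eq_big_nat _ _ (F2 := fun=> nat_of_bool (a == m))); last first.
  by move=> k /andP[ak _]; rewrite discard_cons // ltnNge ak.
rewrite !big_const_nat !iter_addn !addn0 subn0.
have [a1|a1] := eqVneq a 1%N.
  by rewrite a1; case: (head _ c == m); case: (eqVneq m 1%N) => [->|]; lia.
have -> : (a.-1 == m) = (a == m.+1) by lia.
by case: (eqVneq a m.+1) => [->|]; [|case: (eqVneq a m) => [->|]]; lia.
Qed.

Section RealProbability.
Context d (T : measurableType d) (R : realType) (P : probability T R).

Lemma prob_ge0 A : 0 <= fine (P A). Proof. by rewrite fine_ge0. Qed.

Lemma probT : fine (P setT) = 1. Proof. by rewrite probability_setT. Qed.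

Lemma prob_fin (A : set T) : measurable A -> (fine (P A))%:E = P A.
Proof. by move=> mA; rewrite fineK // fin_num_measure. Qed.

(** If [P E = 0] both sides are 0, so the conditional probability matters only for a non-null
    [E]. *)
Lemma probM (A E : set T) (x : R) : measurable A -> measurable E ->
  (P E != 0%E -> condprob P A E = x) -> fine (P (A `&` E)) = x * fine (P E).
Proof.
move=> mA mE; have [PE _|PE /(_ isT)] := eqVneq (P E) 0%E.
  have mAE : measurable (A `&` E) by exact: measurableI.
  suff -> : P (A `&` E) = 0%E by rewrite PE mulr0.
  by apply/eqP; rewrite -measure_le0 -PE le_measure // inE.
rewrite /condprob => <-; rewrite divfK //.
by apply: contra PE => /eqP PE0; rewrite -prob_fin // PE0.
Qed.

Lemma measurable_countable_preimage (I : countType) (f : T -> I) :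
  (forall i, measurable [set w | f w = i]) ->
  forall S : set I, measurable [set w | S (f w)].
Proof.
move=> mf S.
rewrite (_ : [set _ | _] = \bigcup_(n in [set n | exists2 i, S i & pickle i = n])
    [set w | pickle (f w) = n]); last first.
  apply/seteqP; split => [w Sw|w [n [i Si <-] /= /(pcan_inj pickleK) ->]//].
  by exists (pickle (f w)) => //; exists (f w).
apply: bigcup_measurable => n [i Si <-].
rewrite (_ : [set _ | _] = [set w | f w = i]) //.
by apply/seteqP; split => w /=; [exact: (pcan_inj pickleK)|move=> ->].
Qed.

Lemma prob_partition (I : countType) (f : T -> I) (A : set T) (s : seq I) :
  (forall i, measurable [set w | f w = i]) -> measurable A -> uniq s ->
  (forall w, A w -> f w \in s) ->
  fine (P A) = \sum_(i <- s) fine (P (A `&` [set w | f w = i])).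
Proof.
move=> mf mA us As.
have mfs t : measurable (A `&` [set w | f w \in t]).
  by apply: measurableI => //; apply: (measurable_countable_preimage mf [set i | i \in t]).
have mfi i : measurable (A `&` [set w | f w = i]) by apply: measurableI.
rewrite -[in LHS](setIidl (B := [set w | f w \in s]) (A := A)) //.
elim: s us {As} => [|i s IH] /= us.
  by rewrite big_nil (_ : _ `&` _ = set0) ?measure0 // -subset0 => w [].
case/andP: us => nis us; rewrite big_cons -IH //.
rewrite (_ : A `&` _ = (A `&` [set w | f w = i]) `|` (A `&` [set w | f w \in s])); last first.
  apply/seteqP; split => w /=; rewrite inE.
    by case=> Aw /orP[/eqP|]; [left|right].
  by case=> -[Aw]; [move=> ->; rewrite eqxx|move=> ->; rewrite orbT].
rewrite measureU // ?fineD ?fin_num_measure //.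
by rewrite -subset0 => w [[_ /= ->]] [_]; rewrite /= (negbTE nis).
Qed.

End RealProbability.

(** * Regenerative composition structures *)

Section CompositionStructure.
Context d (T : measurableType d) (R : realType) (P : probability T R).
Variable C : {RV P >-> comp_seqs}.

Definition comp_prob (n : nat) (c : seq nat) : R := fine (P [set w | C w n = c]).
Definition first_part_prob (n m : nat) : R := fine (P [set w | head 0%N (C w n) = m]).

Lemma measurable_comp_eq (n : nat) (c : seq nat) : measurable [set w | C w n = c].
Proof.
apply: (measurable_funPTI C (Y := [set e : nat -> seq nat | e n = c])).
by apply: sub_sigma_algebra; exists n, c.
Qed.

Lemma measurable_comp n (S : set (seq nat)) : measurable [set w | S (C w n)].
Proof. by apply: (@measurable_countable_preimage _ _ _ (fun w => C w n)) => c; apply: measurable_comp_eq. Qed.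

Hypothesis Ccomp : forall w n, is_composition n (C w n).

Lemma prob_comp n (A : set T) : measurable A ->
  fine (P A) = \sum_(c <- compositions n) fine (P (A `&` [set w | C w n = c])).
Proof.
move=> mA; apply: prob_partition => //; first exact: measurable_comp_eq.
  exact: compositions_uniq.
by move=> w _; rewrite mem_compositions.
Qed.

Lemma prob_compE n (S : pred (seq nat)) :
  fine (P [set w | S (C w n)]) = \sum_(c <- compositions n | S c) comp_prob n c.
Proof.
rewrite (prob_comp n); last exact: (measurable_comp n [set c | S c]).
rewrite [RHS]big_mkcond /=; apply: eq_bigr => c _.
case: ifP => Sc.
  by congr (fine (P _)); apply/seteqP; split => w /= => [[]//|Cc]; rewrite Cc.
rewrite (_ : _ `&` _ = set0) ?measure0 // -subset0 => w [/= + Cc].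
by rewrite Cc Sc.
Qed.

Lemma comp_prob0 n c : ~~ is_composition n c -> comp_prob n c = 0.
Proof.
move=> nc; rewrite /comp_prob (_ : [set _ | _] = set0) ?measure0 // -subset0 => w /= Cc.
by move: nc; rewrite -Cc Ccomp.
Qed.

Lemma comp_prob_nil : comp_prob 0 [::] = 1.
Proof.
rewrite /comp_prob (_ : [set _ | _] = setT) ?probT // -subTset => w _ /=.
by have := Ccomp w 0; case: (C w 0%N) => [//|[|a] c] /andP[//].
Qed.

Lemma first_part_full n : (0 < n)%N -> first_part_prob n n = comp_prob n [:: n].
Proof.
move=> n0; congr (fine (P _)); apply/seteqP; split => w /= => [|->//].
have := Ccomp w n; case: (C w n) => [/andP[_ /= /eqP n00]|a c].
  by move: n0; rewrite -n00.
rewrite is_composition_cons /= => /andP[_ cc] an; rewrite an in cc *; move: cc.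
by rewrite subnn; case: c => [//|[|b] c] /andP[].
Qed.

Lemma first_part_sum n : (0 < n)%N -> \sum_(1 <= m < n.+1) first_part_prob n m = 1.
Proof.
move=> n0; rewrite -(probT P).
rewrite [RHS](@prob_partition _ _ _ _ _ (fun w => head 0%N (C w n)) _ (index_iota 1 n.+1)) //.
- by apply: eq_bigr => m _; rewrite setTI.
- by move=> m; apply: (measurable_comp n [set c | head 0%N c = m]).
- exact: iota_uniq.
move=> w _; rewrite mem_index_iota.
have := Ccomp w n; case: (C w n) => [/andP[_ /= /eqP n00]|a c].
  by move: n0; rewrite -n00.
by rewrite is_composition_cons ltnS => /andP[].
Qed.

Hypothesis Cdiscard : forall (n : nat) (c c' : seq nat), (1 < n)%N ->
  P [set w | C w n = c] != 0%E ->
  condprob P [set w | C w n.-1 = c'] [set w | C w n = c] =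
  #|[pred k : 'I_n | discard c k == c']|%:R / n%:R.

Lemma discard_prob (n : nat) (c c' : seq nat) : (0 < n)%N ->
  fine (P ([set w | C w n = c'] `&` [set w | C w n.+1 = c])) =
  (\sum_(k < n.+1) (discard c k == c'))%:R / n.+1%:R * comp_prob n.+1 c.
Proof.
move=> n0; apply: probM; [exact: measurable_comp_eq|exact: measurable_comp_eq|].
move=> /(Cdiscard c' (_ : (1 < n.+1)%N)) ->//.
by rewrite -sum1_card big_mkcond /=; congr (_%:R / _); apply: eq_bigr => k _; rewrite inE.
Qed.

(** Given [C n.+1 = c], the first part of [C n] is that of [discard c k] for a uniform ball [k]; the
    factor [n.+1] turns the probability into a count of balls. *)
Lemma first_part_discard n m : (0 < n)%N ->
  n.+1%:R * first_part_prob n m =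
  \sum_(c <- compositions n.+1)
     (\sum_(k < n.+1) (head 0%N (discard c k) == m))%:R * comp_prob n.+1 c.
Proof.
move=> n0; rewrite /first_part_prob (prob_comp n.+1); last first.
  by apply: (measurable_comp n [set c | head 0%N c = m]).
rewrite mulr_sumr; apply: eq_big_seq => c; rewrite mem_compositions => cc.
rewrite (prob_comp n); last first.
  apply: measurableI; first by apply: (measurable_comp n [set c | head 0%N c = m]).
  exact: measurable_comp_eq.
transitivity (n.+1%:R * \sum_(c' <- compositions n | head 0%N c' == m)
   (\sum_(k < n.+1) (discard c k == c'))%:R / n.+1%:R * comp_prob n.+1 c).
  congr (_ * _); rewrite [RHS]big_mkcond; apply: eq_bigr => c' _.
  rewrite setIAC; case: eqP => hc.
    rewrite -discard_prob //; congr (fine (P _)).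
    by apply/seteqP; split => w /= => [[[]]|[Cc']] //; rewrite Cc'.
  rewrite (_ : _ `&` _ = set0) ?measure0 // -subset0 => w [[/= + Cc'] _].
  by rewrite Cc'.
rewrite -!mulr_suml mulrA [n.+1%:R * _]mulrC divfK ?pnatr_eq0 //.
rewrite -natr_sum; congr (_%:R * _).
rewrite exchange_big /=; apply: eq_bigr => k _.
have kc : discard c k \in compositions n.
  by rewrite mem_compositions discard_composition // -ltnS.
rewrite (eq_bigr (fun c' => if discard c k == c' then 1 else 0)%N); last by move=> ? _; case: eqP.
rewrite -big_mkcondr /= sum1_count.
rewrite (eq_count (a2 := fun c' => (c' == discard c k) && (head 0%N (discard c k) == m))); last first.
  by move=> c' /=; rewrite andbC eq_sym; case: eqP => // ->.
case: (head _ _ == m).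
  rewrite (eq_count (a2 := pred1 (discard c k))); last by move=> c' /=; rewrite andbT.
  by rewrite count_uniq_mem ?compositions_uniq // kc.
by rewrite (eq_count (a2 := pred0)) ?count_pred0 // => c' /=; rewrite andbF.
Qed.

Hypothesis Cregen : regenerative_structure C.

Lemma regen_prob n m (S : pred (seq nat)) : (0 < m < n)%N ->
  fine (P [set w | S (behead (C w n)) /\ head 0%N (C w n) = m]) =
  first_part_prob n m * fine (P [set w | S (C w (n - m)%N)]).
Proof.
move=> mn; rewrite prob_compE mulr_sumr.
have mhead : measurable [set w | head 0%N (C w n) = m].
  by apply: (measurable_comp n [set c | head 0%N c = m]).
rewrite (@prob_partition _ _ _ _ _ (fun w => behead (C w n)) _ (compositions (n - m))).
- rewrite [RHS]big_mkcond; apply: eq_bigr => s _; case: ifP => Ss.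
    rewrite mulrC; transitivity
      (fine (P ([set w | behead (C w n) = s] `&` [set w | head 0%N (C w n) = m]))).
      congr (fine (P _)); apply/seteqP; split => w /=; first by case=> -[].
      by case=> Cs Cm; rewrite Cs.
    apply: probM => //; first by apply: (measurable_comp n [set c | behead c = s]).
    exact: Cregen.
  rewrite (_ : _ `&` _ = set0) ?measure0 // -subset0 => w [/= [+ _] Cs].
  by rewrite Cs Ss.
- by move=> s; apply: (measurable_comp n [set c | behead c = s]).
- by apply: (measurable_comp n [set c | S (behead c) /\ head 0%N c = m]).
- exact: compositions_uniq.
- move=> w [_ hm]; rewrite mem_compositions; have := Ccomp w n.
  case: (C w n) hm => [/= m0|a c /= <-]; first by move: mn; rewrite -m0.
  by rewrite is_composition_cons => /andP[].
Qed.

(** The ball count is averaged over [C n.+1]. In its last term, regeneration after a first part 1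
    factors the probability that the first two parts are 1 and [m]. *)
Lemma first_part_decrement : decrement_matrix first_part_prob.
Proof.
split=> [n m|n|n m mn]; [exact: prob_ge0|exact: first_part_sum|].
rewrite first_part_discard; last by lia.
transitivity (\sum_(c <- compositions n.+1)
  (m.+1%:R * ((head 0%N c == m.+1)%:R * comp_prob n.+1 c) +
   (n.+1 - m)%:R * ((head 0%N c == m)%:R * comp_prob n.+1 c) +
   ((head 0%N c == 1%N) && (head 0%N (behead c) == m))%:R * comp_prob n.+1 c)).
  apply: eq_big_seq => c; rewrite mem_compositions => cc.
  by rewrite sum_head_discard //; [rewrite !natrD !natrM; ring|lia|lia].
have sumb (S : pred (seq nat)) : \sum_(c <- compositions n.+1) (S c)%:R * comp_prob n.+1 c =
    fine (P [set w | S (C w n.+1)]).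
  rewrite prob_compE [RHS]big_mkcond; apply: eq_bigr => c _.
  by case: (S c); rewrite ?mul1r ?mul0r.
rewrite !big_split /= -!mulr_sumr !(sumb (fun c => head 0%N c == _)).
rewrite (sumb (fun c => (head 0%N c == 1%N) && (head 0%N (behead c) == m))).
have hE k : fine (P [set w | head 0%N (C w n.+1) == k]) = first_part_prob n.+1 k.
  by congr (fine (P _)); apply/seteqP; split => w /= /eqP.
rewrite !hE; congr (_ + _).
have := @regen_prob n.+1 1 (fun c => head 0%N c == m) ltac:(lia).
have <- : fine (P [set w | head 0%N (C w n) == m]) = first_part_prob n m.
  by congr (fine (P _)); apply/seteqP; split => w /= /eqP.
rewrite subn1 /= => <-; congr (fine (P _)); apply/seteqP; split => w /=.
  by move=> /andP[/eqP].
by case=> -> ->.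
Qed.

Lemma comp_prob_cons n m c : (0 < m < n)%N ->
  comp_prob n (m :: c) = first_part_prob n m * comp_prob (n - m) c.
Proof.
move=> mn; have := @regen_prob n m (pred1 c) mn.
rewrite (_ : [set w | pred1 c _] = [set w | C w (n - m)%N = c]); last first.
  by apply/seteqP; split => w /= /eqP.
move=> <-; congr (fine (P _)); apply/seteqP; split => w /=; first by move=> ->.
by case=> /eqP; case: (C w n) => [|a s] /= -> => [m0|->//]; move: mn; rewrite -m0.
Qed.

End CompositionStructure.

(** * From one-dimensional marginals to the law of the whole sequence *)

Definition past_event (n : nat) (e : nat -> seq nat) : set (nat -> seq nat) :=
  [set c | forall k, (0 < k <= n)%N -> c k = e k].

(** Two cylinders that fix all coordinates up to some index are nested or disjoint; with [set0] and
    [setT] added they are stable under intersection and cover the space. *)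
Definition initial_segments : set (set (nat -> seq nat)) :=
  [set B | B = setT \/ B = set0 \/
    exists n e, B = [set c | forall k, (k <= n)%N -> c k = e k]].

Lemma measurable_initial_segments :
  @measurable _ comp_seqs = <<s initial_segments >>.
Proof.
apply/seteqP; split; apply: smallest_sub; try exact: smallest_sigma_algebra.
  move=> _ [n [s ->]].
  (* The union runs over all finite sequences [l], read as prescribed initial values; those with the
     wrong value at [n] give [set0]. *)
  pose F j := if unpickle j is Some l then
      if nth [::] l n == s then [set c | forall k, (k <= n)%N -> c k = nth [::] l k]
      else set0 else set0.
  rewrite (_ : [set _ | _] = \bigcup_j F j).
    apply: sigma_algebra_bigcup => j; apply: sub_sigma_algebra; rewrite /F.
    case: unpickle => [l|]; last by right; left.
    by case: eqP => ?; right; [right; exists n, (nth [::] l)|left].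
  apply/seteqP; split => [c /= cn|c [j _]].
    exists (pickle (mkseq c n.+1)) => //; rewrite /F pickleK.
    by rewrite nth_mkseq // cn eqxx => k kn; rewrite nth_mkseq.
  by rewrite /F; case: unpickle => // l; case: eqP => //= <- /(_ n); apply.
move=> _ [->|[->|[n [e ->]]]].
- exact: (@measurableT _ comp_seqs).
- exact: (@measurable0 _ comp_seqs).
rewrite (_ : [set _ | _] =
   \bigcap_(k in `I_n.+1) [set c : comp_seqs | c k = e k]); last first.
  by apply/seteqP; split => c /= H k; [move=> /= kn; apply: H|exact: H].
apply: (@fin_bigcap_measurable _ comp_seqs) => // k _.
by apply: sub_sigma_algebra; exists k, (e k).
Qed.

Lemma initial_segments_setI : setI_closed initial_segments.
Proof.
suff H n n' e e' : (n <= n')%N ->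
    initial_segments ([set c | forall k, (k <= n)%N -> c k = e k] `&`
                      [set c | forall k, (k <= n')%N -> c k = e' k]).
  move=> _ _ [->|[->|[n [e ->]]]] [->|[->|[n' [e' ->]]]];
    rewrite ?setIT ?setTI ?setI0 ?set0I; try by [left|right; left].
  - by right; right; exists n', e'.
  - by right; right; exists n, e.
  - by have [|/ltnW] := leqP n n' => ?; [|rewrite setIC]; apply: H.
move=> nn'; have [ee'|ee'] := pselect (forall k, (k <= n)%N -> e k = e' k).
  right; right; exists n', e'; apply/seteqP; split => c /=; first by case.
  move=> H; split => // k kn; rewrite ee' //; apply: H; exact: leq_trans nn'.
right; left; rewrite -subset0 => c [/= H H']; apply: ee' => k kn.
by rewrite -H // -H' // (leq_trans kn).
Qed.

Section CompositionLaw.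
Context d1 d2 (T1 : measurableType d1) (T2 : measurableType d2) (R : realType).
Context (P1 : probability T1 R) (P2 : probability T2 R).
Context (C1 : {RV P1 >-> comp_seqs}) (C2 : {RV P2 >-> comp_seqs}).

(** By regeneration the probability of a composition is a product of entries of the decrement
    matrix, one for each part. *)
Lemma comp_prob_unique :
  regenerative_composition_structure C1 -> regenerative_composition_structure C2 ->
  (forall n, (1 < n)%N -> comp_prob C1 n [:: n] = comp_prob C2 n [:: n]) ->
  forall n c, comp_prob C1 n c = comp_prob C2 n c.
Proof.
move=> [[cc1 _ disc1] reg1] [[cc2 _ disc2] reg2] full n c.
have q12 := decrement_unique (first_part_decrement cc1 disc1 reg1)
  (first_part_decrement cc2 disc2 reg2).
have {}q12 k m : (0 < m <= k)%N -> first_part_prob C1 k m = first_part_prob C2 k m.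
  apply: q12 => j j1; rewrite !first_part_full ?full //; exact: ltnW.
have [cn|] := boolP (is_composition n c); last first.
  by move=> nc; rewrite !comp_prob0.
elim: c n cn => [|m c IH] n.
  by move=> /andP[_ /= /eqP <-]; rewrite !comp_prob_nil.
rewrite is_composition_cons => /andP[/andP[m0 mn] cn].
have [mn'|nm] := ltnP m n.
  by rewrite !comp_prob_cons ?m0 // IH // q12 // m0.
have {nm} mn' : m = n by lia.
move: cn; rewrite mn' subnn; case: c {IH} => [_|[|b] c /andP[]//].
by rewrite -!first_part_full -?mn' // q12 // m0 leqnn.
Qed.

(** The backward kernel [discard] is common to both sequences. With the marginals it gives the joint
    law of consecutive terms, hence the forward transition probabilities, which the Markov property
    multiplies along the path. *)
Lemma past_event_prob : composition_structure C1 -> composition_structure C2 ->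
  (forall n c, comp_prob C1 n c = comp_prob C2 n c) ->
  forall n e, (0 < n)%N ->
  fine (P1 (C1 @^-1` past_event n e)) = fine (P2 (C2 @^-1` past_event n e)).
Proof.
move=> [cc1 mk1 disc1] [cc2 mk2 disc2] p12.
have one d (T : measurableType d) (P : probability T R) (C : {RV P >-> comp_seqs}) e :
    fine (P (C @^-1` past_event 1 e)) = comp_prob C 1 (e 1%N).
  congr (fine (P _)); apply/seteqP; split => w /=; first exact.
  by move=> H k; rewrite -eqn_leq => /eqP <-.
have mpast d (T : measurableType d) (P : probability T R) (C : {RV P >-> comp_seqs}) n e :
    measurable (C @^-1` past_event n e).
  rewrite (_ : _ @^-1` _ = \bigcap_(k in [set k | (0 < k <= n)%N]) [set w | C w k = e k]).
    by apply: bigcap_measurableType => k _; apply: measurable_comp_eq.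
  by apply/seteqP; split => w /=.
have step d (T : measurableType d) (P : probability T R) (C : {RV P >-> comp_seqs}) n e :
    composition_structure C -> (0 < n)%N ->
    fine (P (C @^-1` past_event n.+1 e)) =
    ((\sum_(k < n.+1) (discard (e n.+1) k == e n))%:R / n.+1%:R * comp_prob C n.+1 (e n.+1))
     / comp_prob C n (e n) * fine (P (C @^-1` past_event n e)).
  move=> [cc mk disc] n0; rewrite -(discard_prob disc) // setIC.
  transitivity (fine (P ([set w | C w n.+1 = e n.+1] `&` (C @^-1` past_event n e)))).
    congr (fine (P _)); apply/seteqP; split => w /=.
      by move=> H; split => [|k /andP[k0 kn]]; apply: H; rewrite ?leqnn // k0 (leqW kn).
    move=> [H1 H2] k /andP[k0]; rewrite leq_eqVlt => /orP[/eqP -> //|kn].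
    by apply: H2; rewrite k0.
  by apply: probM; [exact: measurable_comp_eq|exact: mpast|exact: mk].
elim=> [//|[|n] IH] e _; first by rewrite !one p12.
by rewrite (step _ _ _ C1) // (step _ _ _ C2) // IH // !p12.
Qed.

Lemma composition_law_unique :
  regenerative_composition_structure C1 -> regenerative_composition_structure C2 ->
  (forall n, (1 < n)%N -> comp_prob C1 n [:: n] = comp_prob C2 n [:: n]) ->
  same_law C1 C2.
Proof.
move=> r1 r2 full B mB; have p12 := comp_prob_unique r1 r2 full.
have [[s1 _] [s2 _]] := (r1, r2).
apply: (@measure_unique _ R comp_seqs initial_segments (fun=> setT) _ _ _ _ (distribution P1 C1) (distribution P2 C2)) => //.
- exact: measurable_initial_segments.
- exact: initial_segments_setI.
- by move=> _; left.
- by apply/seteqP; split => // c _; exists 0%N.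
(* Initial segments also prescribe the value at index 0, which past events ignore; that value is
   always the empty composition. *)
- have nil0 d (T : measurableType d) (P : probability T R) (C : {RV P >-> comp_seqs}) w :
      composition_structure C -> C w 0%N = [::].
    by move=> [/(_ w 0%N) + _ _]; case: (C w 0%N) => [//|[|a] c] /andP[].
  move=> _ [->|[->|[n [e ->]]]]; 
    [exact: etrans (probability_setT (distribution P1 C1))
              (esym (probability_setT (distribution P2 C2)))
    |exact: etrans (measure0 (distribution P1 C1)) (esym (measure0 (distribution P2 C2)))|].
  set S := [set c | _]; change (P1 (C1 @^-1` S) = P2 (C2 @^-1` S)).
  have [e0|e0] := eqVneq (e 0%N) [::]; last first.
    rewrite [X in P1 X](_ : _ = set0) ?[X in P2 X](_ : _ = set0) ?measure0 //;
      rewrite -subset0 => w /= /(_ 0%N isT); rewrite nil0 // => /esym/eqP;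
      by rewrite (negbTE e0).
  have segE d (T : measurableType d) (P : probability T R) (C : {RV P >-> comp_seqs}) :
      composition_structure C ->
      C @^-1` S = C @^-1` past_event n e.
    move=> sC; apply/seteqP; split => w /= H [|k] kn; try by apply: H.
    by rewrite nil0.
  rewrite !segE //; case: n @S segE => [|n] S segE.
    rewrite [X in P1 X](_ : _ = setT) ?[X in P2 X](_ : _ = setT) ?probability_setT //;
      by rewrite -subTset => w _ [|k].
  have mE d (T : measurableType d) (P : probability T R) (C : {RV P >-> comp_seqs}) :
      composition_structure C -> measurable (C @^-1` past_event n.+1 e).
    move=> sC; rewrite -segE //; apply: measurable_funPTI.
    by rewrite measurable_initial_segments; apply: sub_sigma_algebra; right; right; exists n.+1, e.
  by rewrite -(prob_fin P1 (mE _ _ _ C1 s1)) -(prob_fin P2 (mE _ _ _ C2 s2)) (past_event_prob s1 s2 p12).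
- by move=> _; apply: le_lt_trans (ltry 1); rewrite -(probability_setT (distribution P1 C1)).
Qed.

End CompositionLaw.

(** * One-block probabilities *)

Lemma partition_structure_one_block d1 d2 (T1 : measurableType d1) (T2 : measurableType d2)
    (R : realType) (P1 : probability T1 R) (P2 : probability T2 R)
    (C1 : {RV P1 >-> comp_seqs}) (C2 : {RV P2 >-> comp_seqs}) n :
  same_partition_structure C1 C2 -> (0 < n)%N ->
  comp_prob C1 n [:: n] = comp_prob C2 n [:: n].
Proof.
move=> H n0; have := H n [:: n] n0.
have sortE s : (sort geq s = [:: n]) = (s = [:: n]).
  apply/propext; split => [E|->//].
  have : perm_eq s [:: n] by rewrite -E perm_sym perm_sort.
  by move/perm_small_eq => ->.
by rewrite /comp_prob; under eq_set do rewrite sortE; under [X in _ = P2 X]eq_set do rewrite sortE; move=> ->.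
Qed.

(** For the relation that is always true, the event is [C n = [:: n]] whatever the labelling, so the
    average over ['S_n] has equal terms. *)
Lemma corresponds_one_block d1 d2 (T1 : measurableType d1) (T2 : measurableType d2)
    (R : realType) (P1 : probability T1 R) (Pi : {RV P1 >-> partitions})
    (P2 : probability T2 R) (C : {RV P2 >-> comp_seqs}) n :
  (forall w n, is_composition n (C w n)) -> corresponds Pi C -> (0 < n)%N ->
  comp_prob C n [:: n] = fine (P1 [set w | forall i j : 'I_n, Pi w i j = true]).
Proof.
move=> cc H n0; rewrite (H n (fun _ _ => true) n0).
rewrite (eq_bigr (fun=> comp_prob C n [:: n])); last first.
  move=> s _; congr (fine (P2 _)); apply/seteqP; split => w /=; last first.
    move=> -> i j; rewrite /labelled_partition !reshape_index_cons.
    by rewrite !(ltn_ord) eqxx.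
  move=> same; have := cc w n; case: (C w n) same => [|a c] same.
    by move=> /andP[_ /= /eqP E]; move: n0; rewrite -E.
  rewrite is_composition_cons => /andP[/andP[a0 an] cn].
  have same' (i j : 'I_n) : reshape_index (a :: c) i = reshape_index (a :: c) j.
    have := same (s^-1 i)%g (s^-1 j)%g.
    by rewrite /labelled_partition !permKV => /eqP.
  have n1 : (n.-1 < n)%N by rewrite prednK.
  (* Boxes are filled in order, so it suffices to compare the first ball with the last. *)
  have := same' (Ordinal n0) (Ordinal n1).
  rewrite !reshape_index_cons /= a0; case: ltnP => // na _.
  have {na an} an : a = n by lia.
  by move: cn; rewrite an subnn; case: c {same same'} => [//|[|b] c] /andP[].
rewrite sumr_const card_Sn -[comp_prob _ _ _ *+ _]mulr_natr mulfK //.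
Qed.

Lemma same_partition_structure_law d1 d2 (T1 : measurableType d1) (T2 : measurableType d2)
    (R : realType) (P1 : probability T1 R) (P2 : probability T2 R)
    (C1 : {RV P1 >-> comp_seqs}) (C2 : {RV P2 >-> comp_seqs}) :
  regenerative_composition_structure C1 ->
  regenerative_composition_structure C2 ->
  same_partition_structure C1 C2 -> same_law C1 C2.
Proof.
move=> r1 r2 H; apply: composition_law_unique => // n n1.
by apply: partition_structure_one_block H _; apply: ltnW.
Qed.

Lemma corresponds_law d d1 d2 (T : measurableType d)
    (T1 : measurableType d1) (T2 : measurableType d2) (R : realType)
    (P : probability T R) (P1 : probability T1 R) (P2 : probability T2 R)
    (Pi : {RV P >-> partitions})
    (C1 : {RV P1 >-> comp_seqs}) (C2 : {RV P2 >-> comp_seqs}) :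
  regenerative_composition_structure C1 ->
  regenerative_composition_structure C2 ->
  corresponds Pi C1 -> corresponds Pi C2 -> same_law C1 C2.
Proof.
move=> r1 r2 H1 H2; apply: composition_law_unique => // n n1.
have [[[c1 _ _] _] [[c2 _ _] _]] := (r1, r2).
by rewrite (corresponds_one_block c1 H1 (ltnW n1)) (corresponds_one_block c2 H2 (ltnW n1)).
Qed.

(** * The next point of a closed set *)

Section NextPoint.
Variable R : realType.
Implicit Types (A : set R) (u v x y z : R).

(* Adding [1] makes [nextpt] agree with [Dpoint] on closed sets containing [1]
   and, unlike [Dpoint], measurable in an arbitrary set [A]. *)
Definition nextpt A u : R := inf ((A `|` [set 1]) `&` `]u, 1]).

(** Recovers the next point from the past, so that regeneration, which speaks of the past as a set,
    applies to the next point. The added 0 and the cap at 1 keep the supremum meaningful for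
    arbitrary [A]. *)
Definition lastpt A : R := sup [set Num.min x 1 | x in A `|` [set 0]].

Lemma nextpt_neq0 A u : u < 1 -> (A `|` [set 1]) `&` `]u, 1] !=set0.
Proof. by move=> u1; exists 1; split; [right|rewrite /= in_itv /= u1 lexx]. Qed.

Lemma nextpt_ge A u : u < 1 -> u <= nextpt A u.
Proof.
move=> u1; apply: lb_le_inf; first exact: nextpt_neq0.
by move=> x [_]; rewrite /= in_itv /= => /andP[/ltW].
Qed.

Lemma nextpt_le A u x : A x \/ x = 1 -> u < x <= 1 -> nextpt A u <= x.
Proof.
move=> Ax ux; apply: ge_inf.
  by exists u => y [_]; rewrite /= in_itv /= => /andP[/ltW].
by split => //; rewrite /= in_itv.
Qed.

Lemma nextpt_le1 A u : u < 1 -> nextpt A u <= 1.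
Proof. by move=> u1; apply: nextpt_le; [right|rewrite u1 lexx]. Qed.

Lemma nextpt_ltP A u y : u < 1 ->
  (nextpt A u < y) <-> exists x, [/\ A x \/ x = 1, u < x <= 1 & x < y].
Proof.
move=> u1; split => [|[x [Ax ux xy]]]; last exact: le_lt_trans (nextpt_le Ax ux) xy.
move=> /(inf_lt (nextpt_neq0 A u1))[x [Ax]]; rewrite /= in_itv /= => ux xy.
by exists x.
Qed.

Lemma nextpt_hit A u y : u < 1 -> y <= 1 ->
  (nextpt A u < y) <-> A `&` `]u, y[ !=set0.
Proof.
move=> u1 y1; rewrite nextpt_ltP //; split=> [[x [Ax /andP[ux x1] xy]]|[x [Ax]]].
  exists x; split; last by rewrite /= in_itv /= ux.
  by case: Ax => // x1'; move: xy; rewrite x1' ltNge y1.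
rewrite /= in_itv /= => /andP[ux xy]; exists x; split => //; first by left.
by rewrite ux (le_trans (ltW xy)).
Qed.

Lemma nextpt_mono A u v : u <= v -> v < 1 -> nextpt A u <= nextpt A v.
Proof.
move=> uv v1; rewrite leNgt; apply/negP => /(nextpt_ltP A _ v1)[x [Ax /andP[vx x1]]].
by rewrite ltNge nextpt_le // (le_lt_trans uv).
Qed.

Lemma nextpt_gap A u v : u <= v -> v < nextpt A u -> nextpt A v = nextpt A u.
Proof.
(* For [1 <= u] the infimum is over the empty set, hence 0, and [v < 0] contradicts [u <= v]. *)
move=> uv vn; have [u1|u1] := ltP u 1; last first.
  move: vn; rewrite /nextpt (_ : _ `&` _ = set0) ?inf0.
    by rewrite ltNge (le_trans ler01) // (le_trans u1).
  by rewrite -subset0 => x [_]; rewrite /= in_itv /= => /andP[ux x1]; have := lt_le_trans ux x1; rewrite ltNge u1.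
have v1 := lt_le_trans vn (nextpt_le1 A u1).
apply: le_anti; rewrite (nextpt_mono A uv v1) andbT leNgt; apply/negP.
move=> /(nextpt_ltP _ _ u1)[x [Ax /andP[ux x1] xn]].
have [vx|xv] := ltP v x; first by move: xn; rewrite ltNge nextpt_le // vx.
by move: (le_lt_trans xv vn); rewrite ltNge nextpt_le // ux.
Qed.

Lemma nextpt_notin A u x : u < x -> x <= 1 -> x < nextpt A u -> ~ A x.
Proof. by move=> ux x1 xn Ax; move: xn; rewrite ltNge nextpt_le ?ux //; left. Qed.

Lemma lt_eqr x y : (forall s, (x < s) <-> (y < s)) -> x = y.
Proof.
by move=> H; case: (ltgtP x y) => // [/(H y).1|/(H x).2]; rewrite ltxx.
Qed.

Section Closed01.
Variable A : set R.
Hypothesis A01 : is_closed01 A.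

Let A1 : A `|` [set 1] = A.
Proof. by apply/seteqP; split => x; [case=> // ->; case: A01|left]. Qed.

Lemma DpointE u : Dpoint A u = nextpt A u. Proof. by rewrite /nextpt A1. Qed.

Lemma nextpt_in u : u < 1 -> A (nextpt A u).
Proof.
move=> u1; have [clA _ _ _] := A01; apply: clA => B /nbhs_ballP[e /= e0 eB].
have hi : has_inf ((A `|` [set 1]) `&` `]u, 1]).
  split; first exact: nextpt_neq0.
  by exists u => y [_]; rewrite /= in_itv /= => /andP[/ltW].
have [x [Ax ux] xe] := inf_adherent e0 hi.
exists x; rewrite -A1; split => //; apply: eB; rewrite /ball /= ltr_norml.
have : nextpt A u <= x by apply: ge_inf => //; case: hi.
by rewrite /nextpt; lra.
Qed.

Lemma lastpt_past u : 0 <= u < 1 -> lastpt (`[0, nextpt A u] `&` A) = nextpt A u.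
Proof.
move=> /andP[u0 u1]; have n1 := nextpt_le1 A u1; have nu := nextpt_ge A u1.
have n0 := le_trans u0 nu.
apply/eqP; rewrite eq_le; apply/andP; split.
  apply: ge_sup; first by exists 0; exists 0; [right|rewrite min_l].
  move=> _ [x [[+ _]|->] <-]; last by rewrite min_l.
  by rewrite /= in_itv /= => /andP[_ xn]; rewrite ge_min xn.
apply: ub_le_sup; first by exists 1 => _ [x _ <-]; rewrite ge_min lexx orbT.
exists (nextpt A u); last by rewrite min_l.
by left; split; [rewrite /= in_itv /= lexx n0|exact: nextpt_in].
Qed.

Lemma rescaledE z : z < 1 -> nextpt A z < 1 ->
  rescaled A z = [set x | 0 <= x <= 1 /\ A (nextpt A z + (1 - nextpt A z) * x)].
Proof.
move=> z1 n1; rewrite /rescaled DpointE; set D := nextpt A z.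
have D1 : 1 - D != 0 by rewrite subr_eq0 eq_sym lt_eqF.
have D0 : 0 < 1 - D by rewrite subr_gt0.
apply/seteqP; split => [_ [y [Ay +] <-]|x [/andP[x0 x1] Ax]].
  rewrite /= in_itv /= => /andP[Dy y1]; split.
    rewrite divr_ge0 ?subr_ge0 //=; last exact: ltW.
    by rewrite ler_pdivrMr // mul1r lerD2r.
  by rewrite mulrC divfK // addrC subrK.
exists (D + (1 - D) * x); last by rewrite [D + _]addrC addrK [X in X / _]mulrC mulfK.
split => //; rewrite /= in_itv /= lerDl mulr_ge0 //; last exact: ltW.
by rewrite addrC -lerBrDr ler_piMr // ltW.
Qed.

Section Rescaled.
Variable z : R.
Hypotheses (z1 : z < 1) (n1 : nextpt A z < 1).
Let D := nextpt A z.

Lemma rescaled_closed01 : is_closed01 (rescaled A z).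
Proof.
have [clA Asub A_0 A_1] := A01; rewrite rescaledE //; split.
- apply: closedI; first exact: (@itv_closed _ R 0 1).
  apply: (continuous_closedP (fun x : R => D + (1 - D) * x)).1 => //.
  by move=> x; apply: cvgD; [exact: cvg_cst|apply: cvgM; [exact: cvg_cst|exact: cvg_id]].
- by move=> x [].
- by rewrite /= lexx ler01 mulr0 addr0; split => //; exact: nextpt_in.
- by rewrite /= lexx ler01 mulr1 addrC subrK.
Qed.

(** The increasing affine map that sends 0 to [D] and 1 to 1 carries the rescaled set onto the part
    of [A] from [D] on, so it commutes with taking next points. *)
Lemma nextpt_rescaled x : 0 <= x < 1 ->
  nextpt A (D + (1 - D) * x) = D + (1 - D) * nextpt (rescaled A z) x.
Proof.
move=> /andP[x0 x1]; have D0 : 0 < 1 - D by rewrite subr_gt0.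
have D1 : 1 - D != 0 by rewrite gt_eqF.
have hlt (s t : R) : (D + (1 - D) * s < D + (1 - D) * t) = (s < t).
  by rewrite ltrD2l ltr_pM2l.
have h1 : D + (1 - D) * 1 = 1 by rewrite mulr1 addrC subrK.
have hle1 t : (D + (1 - D) * t <= 1) = (t <= 1) by rewrite -[X in _ <= X]h1 lerD2l ler_pM2l.
have hK t : D + (1 - D) * ((t - D) / (1 - D)) = t.
  by rewrite mulrCA mulfV // mulr1 addrC subrK.
have hx1 : D + (1 - D) * x < 1 by rewrite -[ltRHS]h1 hlt.
apply: lt_eqr => s; rewrite -(hK s); set t := _ / _; rewrite hlt !nextpt_ltP //.
have [_ Asub A_0 A_1] := A01; rewrite rescaledE //.
split=> [[y [Ay /andP[xy y1] yt]]|[y [Ay /andP[xy y1] yt]]].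
  move: xy y1 yt Ay; rewrite -(hK y); set w := _ / _.
  rewrite !hlt hle1 => xw w1 wt Aw.
  exists w; split; rewrite ?xw ?w1 //; left; split; first by rewrite w1 (le_trans x0 (ltW xw)).
  by case: Aw => // ->.
exists (D + (1 - D) * y); split; rewrite ?hlt ?hle1 ?xy //.
by case: Ay => [[]|->]; left => //; rewrite h1.
Qed.

End Rescaled.

(** The left end [g] is the last point of [A] before [x]; it exists because [A] is closed and
    contains 0. The last clause includes [u = g], so the next point is constant on a half-open
    interval. *)
Lemma component_gap x : 0 <= x <= 1 -> ~ A x ->
  exists g, [/\ A g, 0 <= g < nextpt A x, g < x < nextpt A x,
    connected_component (`[0, 1] `\` A) x = `]g, nextpt A x[%classic &
    forall u, g <= u < nextpt A x -> nextpt A u = nextpt A x].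
Proof.
move=> /andP[x0 x1] nAx; have [clA Asub A_0 A_1] := A01.
have {}x1 : x < 1 by rewrite lt_neqAle x1 andbT; apply: contra_notN nAx => /eqP ->.
set d := nextpt A x; have Ad : A d by exact: nextpt_in.
have xd : x < d by rewrite lt_neqAle nextpt_ge // andbT; apply: contra_notN nAx => /eqP ->.
pose S := A `&` `[0, x]; pose g := sup S.
have S0 : S !=set0 by exists 0; split => //=; rewrite in_itv /= lexx.
have uS : ubound S x by move=> y [_]; rewrite /= in_itv /= => /andP[].
have [Ag] : S g.
  have clS : closed S by apply: closedI => //; exact: itv_closed.
  by apply: clS; apply: closure_sup => //; exists x.
rewrite /= in_itv /= => /andP[g0 gx].
have {}gx : g < x by rewrite lt_neqAle gx andbT; apply: contra_notN nAx => /eqP <-.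
have d1 : d <= 1 by exact: nextpt_le1.
have gap y : g < y < d -> ~ A y.
  move=> /andP[gy yd] Ay; have [yx|xy] := leP y x.
    move: gy; rewrite ltNge; apply/negP/negPn; apply: ub_le_sup; first by exists x.
    by split => //; have := Asub _ Ay; rewrite /= !in_itv /= yx => /andP[-> _].
  exact: (nextpt_notin xy (le_trans (ltW yd) d1) yd Ay).
exists g; split; rewrite ?gx ?g0 ?(lt_trans gx xd) //.
- apply/seteqP; split => [y Cy|].
    have icc : is_interval (connected_component (`[0, 1] `\` A) x).
      by apply/connected_intervalP; exact: component_connected.
    have Cx : connected_component (`[0, 1] `\` A) x x.
      by apply: connected_component_refl; split => //=; rewrite in_itv /= x0 ltW.
    have notA t : connected_component (`[0, 1] `\` A) x t -> ~ A t.
      by move=> /connected_component_sub[].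
    rewrite /= in_itv /=; apply/andP; split; rewrite ltNge; apply/negP => Hy.
      by apply: (notA g) Ag; apply: (icc y x) => //; rewrite Hy ltW.
    by apply: (notA d) Ad; apply: (icc x y) => //; rewrite Hy ltW.
  apply: connected_component_max; first by rewrite /= in_itv /= gx.
  + move=> y /=; rewrite !in_itv /= => /andP[gy yd]; split; last by apply: gap; rewrite gy.
    by rewrite (le_trans g0 (ltW gy)) (le_trans (ltW yd)).
  + by apply/connected_intervalP; exact: interval_is_interval.
- move=> u /andP[gu ud]; apply/eqP; rewrite eq_le; apply/andP; split.
    by apply: nextpt_le; [left|rewrite ud].
  rewrite leNgt; apply/negP; have u1 := lt_le_trans ud d1.
  move=> /(nextpt_ltP A _ u1)[y [Ay /andP[uy y1] yd]].
  apply: (@gap y); first by rewrite (le_lt_trans gu).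
  by case: Ay => // ->.
Qed.

End Closed01.
End NextPoint.

(** * Measurability for the Effros sigma-algebra *)

(** Since 0 and 1 belong to [A], hitting an interval becomes a condition on a single next point.
    Measurability and laws can then be checked through [nextpt]. *)
Lemma closed01_hit (R : realType) (A : set R) (a b : R) : is_closed01 A ->
  (A `&` `]a, b[ !=set0) <-> (a < 0 < b) \/ (0 <= a < 1 /\ nextpt A a < b).
Proof.
move=> A01; have [_ Asub A_0 A_1] := A01.
split=> [[x [Ax]]|].
  have := Asub _ Ax; rewrite /= !in_itv /= => /andP[x0 x1] /andP[ax xb].
  have [a0|a0] := ltP a 0; [left|right].
    by rewrite (le_lt_trans x0).
  rewrite (lt_le_trans ax) //; split => //.
  by apply: le_lt_trans xb; apply: nextpt_le; [left|rewrite ax].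
case=> [/andP[a0 b0]|[/andP[a0 a1] nb]].
  by exists 0; split => //; rewrite /= in_itv /= a0.
have [b1|b1] := leP b 1; first by apply/nextpt_hit.
by exists 1; split => //; rewrite /= in_itv /= a1.
Qed.

Section HitMeasurability.
Variable R : realType.

Lemma measurable_hit (G : set R) : open G -> measurable ([set A | A `&` G !=set0] : set (hit_sets R)).
Proof. by move=> oG; apply: sub_sigma_algebra; exists G. Qed.

Lemma open_rational_itv (G : set R) (x : R) : open G -> G x ->
  exists p q : rat, ratr p < x < ratr q /\ `]ratr p, ratr q[ `<=` G.
Proof.
move=> oG Gx; have /nbhs_ballP[e /= e0 eG] : nbhs x G by apply: open_nbhs_nbhs.
have [p] := @rat_in_itvoo R (x - e) x ltac:(lra); rewrite in_itv /= => /andP[p1 p2].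
have [q] := @rat_in_itvoo R x (x + e) ltac:(lra); rewrite in_itv /= => /andP[q1 q2].
exists p, q; rewrite p2 q1; split => // y; rewrite /= in_itv /= => /andP[py yq].
by apply: eG; rewrite /ball /= ltr_norml; lra.
Qed.

(** An open set is a countable union of intervals with rational endpoints, so hitting it is a
    countable union of hitting events of intervals. *)
Lemma hit_measurable_fun d (T : measurableType d) (f : T -> hit_sets R) :
  (forall a b, measurable [set w | f w `&` `]a, b[ !=set0]) -> measurable_fun setT f.
Proof.
move=> mf; apply: (@measurability _ _ T (hit_sets R) setT f (@hitting_sets R)) => //.
move=> _ [_ [G oG ->] <-]; rewrite setTI.
pose F (pq : rat * rat) := if pselect (`]ratr pq.1, ratr pq.2[ `<=` G)
  then [set w | f w `&` `]ratr pq.1, ratr pq.2[ !=set0] else set0.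
rewrite (_ : _ @^-1` _ = \bigcup_pq F pq).
  apply: countable_bigcupT_measurable => [|pq]; first exact: countableP.
  by rewrite /F; case: pselect => ?; [exact: mf|exact: measurable0].
apply/seteqP; split => [w [x [fx Gx]]|w [[p q] _]]; rewrite /F.
  have [p [q [pxq pqG]]] := open_rational_itv oG Gx.
  exists (p, q) => //; case: pselect => // ?.
  by exists x; split => //; rewrite /= in_itv.
by case: pselect => // pqG [x [fx xpq]]; exists x; split => //; apply: pqG.
Qed.

Lemma nextpt_measurable :
  measurable_fun setT (fun p : R * hit_sets R => nextpt p.2 p.1).
Proof.
apply: (measurability _ (measurable_realfun.RGenInftyO.measurableE R)) => _ [_ [y ->] <-].
rewrite setTI.
have mlt (c : R) : measurable [set p : R * hit_sets R | p.1 < c].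
  rewrite (_ : [set _ | _] = `]-oo, c[ `*` setT); first exact: measurableX.
  by apply/seteqP; split => p /=; rewrite in_itv //= => -[].
have out (p : R * hit_sets R) : 1 <= p.1 -> nextpt p.2 p.1 = 0.
  move=> p1; rewrite /nextpt (_ : _ `&` _ = set0) ?inf0 // -subset0 => x [_].
  by rewrite /= in_itv /= => /andP[ux x1]; have := lt_le_trans ux x1; rewrite ltNge p1.
have [y1|y1] := leP y 1; last first.
  rewrite (_ : _ @^-1` _ = setT) // -subTset => p _; rewrite /= in_itv /=.
  have [p1|p1] := ltP p.1 1; first exact: le_lt_trans (nextpt_le1 _ p1) y1.
  by rewrite out //; lra.
(* A rational [q] between [u] and a point of [A] below [y] separates the two variables: the event is
   a countable union of rectangles. *)
pose H (q : rat) := [set p : R * hit_sets R | p.1 < ratr q /\ p.2 `&` `]ratr q, y[ !=set0].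
rewrite (_ : _ @^-1` _ =
   ([set p | p.1 < 1] `&` \bigcup_q H q)
   `|` (~` [set p | p.1 < 1] `&` [set p | 0 < y])); last first.
  apply/seteqP; split => p; rewrite /= in_itv /=.
    have [p1|p1] := ltP p.1 1; last by rewrite out // => ?; right; split => //; rewrite -ltNge.
    move=> /(nextpt_hit _ p1 y1)[x [Ax]]; rewrite /= in_itv /= => /andP[px xy].
    left; split => //; have [q] := rat_in_itvoo px; rewrite in_itv /= => /andP[pq qx].
    exists q => //; split => //; exists x; split => //.
    by rewrite /= in_itv /= qx.
  case=> [[p1 [q _]]|[/negP]].
    move=> [pq [x [Ax]]]; rewrite /= in_itv /= => /andP[qx xy].
    apply/nextpt_hit => //; exists x; split => //.
    by rewrite /= in_itv /= (lt_trans pq qx).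
  by rewrite -leNgt => p1; rewrite out.
apply: measurableU; apply: measurableI.
- exact: mlt.
- apply: countable_bigcupT_measurable => [|q]; first exact: countableP.
  rewrite (_ : H q = `]-oo, ratr q[ `*` [set A | A `&` `]ratr q, y[ !=set0]).
    by apply: measurableX => //; apply: measurable_hit; exact: itv_open.
  by apply/seteqP; split => p /=; rewrite in_itv.
- by apply: measurableC; exact: mlt.
- case: (0 < y); [rewrite (_ : [set _ | _] = setT)|rewrite (_ : [set _ | _] = set0)];
    by [|apply/seteqP; split].
Qed.

Lemma lastpt_measurable : measurable_fun setT (@lastpt R : hit_sets R -> R).
Proof.
apply: (measurability _ (measurable_realfun.RGenOInfty.measurableE R)) => _ [_ [y ->] <-].
rewrite setTI.
have lastP (A : set R) : (y < lastpt A) <-> exists x, (A x \/ x = 0) /\ y < Num.min x 1.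
  split=> [|[x [Ax yx]]].
    have H : [set Num.min x 1 | x in A `|` [set 0]] !=set0.
      by exists (Num.min 0 1); exists 0; [right|].
    by move=> /(sup_gt H)[_ [x Ax <-] yx]; exists x.
  apply: lt_le_trans yx _; apply: ub_le_sup; last by exists x.
  by exists 1 => _ [z _ <-]; rewrite ge_min lexx orbT.
have [y1|y1] := ltP y 1; last first.
  rewrite (_ : _ @^-1` _ = set0) // -subset0 => A; rewrite /= in_itv /= andbT.
  by move=> /lastP[x [_]]; rewrite lt_min => /andP[_]; rewrite ltNge y1.
have [y0|y0] := ltP y 0.
  rewrite (_ : _ @^-1` _ = setT) // -subTset => A _; rewrite /= in_itv /= andbT.
  by apply/lastP; exists 0; rewrite lt_min y0 y1; split => //; right.
rewrite (_ : _ @^-1` _ = [set A | A `&` `]y, +oo[ !=set0]).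
  by apply: measurable_hit; exact: rray_open.
apply/seteqP; split => A; rewrite /= in_itv /= andbT.
  move=> /lastP[x [Ax]]; rewrite lt_min y1 andbT => yx.
  exists x; rewrite /= in_itv /= andbT; split => //.
  by case: Ax => // x0; move: yx; rewrite x0 ltNge y0.
move=> [x [Ax]]; rewrite /= in_itv /= andbT => yx.
by apply/lastP; exists x; rewrite lt_min yx; split => //; left.
Qed.

End HitMeasurability.

Section Restriction.
Local Open Scope ereal_scope.
Context d (T : measurableType d) (R : realType).

Lemma ge0_integral_mrestr (m : {measure set T -> \bar R}) (D : set T) (mD : measurable D)
    (f : T -> \bar R) :
  measurable_fun setT f -> (forall x, 0 <= f x) ->
  \int[mrestr m mD]_x f x = \int[m]_(x in D) f x.
Proof.
move=> mf f0; have mDC : measurable (~` D) by exact: measurableC.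
rewrite -(setvU D) ge0_integral_setU // ?setvU //; last first.
  by apply/disj_setPS; rewrite setICl.
rewrite (@null_set_integral _ _ _ _ (~` D)) ?add0e //; last 2 first.
- exact: measurable_funTS.
- by rewrite /= /mrestr setICl measure0.
apply: eq_measure_integral => A mA AD.
by rewrite /= /mrestr setIidl.
Qed.
End Restriction.

(** * Regeneration at a fixed point *)

Section Regeneration.
Context d (T : measurableType d) (R : realType) (P : probability T R).
Variable X : {RV P >-> hit_sets R}.

Lemma measurable_hit_rv : measurable_fun setT (X : T -> hit_sets R).
Proof. exact: measurable_funP. Qed.

Lemma measurable_nextpt_comp (f : T -> R) : measurable_fun setT f ->
  measurable_fun setT (fun w => nextpt (X w) (f w)).
Proof.
move=> mf.
apply: (measurableT_comp (f := fun p : R * hit_sets R => nextpt p.2 p.1)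
  (g := fun w => (f w, X w))).
  exact: nextpt_measurable.
by apply: measurable_fun_pair => //; exact: measurable_hit_rv.
Qed.

Hypothesis X01 : forall w, is_closed01 (X w).
Variable z : R.
Hypothesis z01 : 0 <= z < 1.

Let D w := nextpt (X w) z.
Let E := [set w | D w < 1].

Let mD : measurable_fun setT D.
Proof. exact: measurable_nextpt_comp. Qed.

Let mlt (f g : T -> R) : measurable_fun setT f -> measurable_fun setT g ->
  measurable [set w | f w < g w].
Proof.
move=> mf mg; rewrite -[X in measurable X]setTI.
exact: (measurable_fun_ltr mf mg measurableT (Y := [set true])).
Qed.

Let mE : measurable E. Proof. exact: mlt. Qed.

(** Where the next point is 1, rescaling would divide by 0. The default [X w] keeps every value a
    closed set containing 0 and 1, so that [closed01_hit] applies everywhere. *)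
Definition future_set w : hit_sets R := if nextpt (X w) z < 1 then rescaled (X w) z else X w.

Lemma future_set_closed01 w : is_closed01 (future_set w).
Proof.
rewrite /future_set; case: ifP => // Dw.
by move/andP: z01 => [z0 z1]; apply: rescaled_closed01.
Qed.

Lemma future_set_measurable : measurable_fun setT future_set.
Proof.
apply: hit_measurable_fun => a b; have /andP[z0 z1] := z01.
rewrite (_ : [set _ | _] =
  (E `&` [set w | (a < 0 < b) \/ (0 <= a < 1 /\
       nextpt (X w) (D w + (1 - D w) * a) < D w + (1 - D w) * b)]) `|`
  (~` E `&` [set w | X w `&` `]a, b[ !=set0])); last first.
  have key w : D w < 1 -> 0 <= a < 1 ->
     (nextpt (rescaled (X w) z) a < b) = (nextpt (X w) (D w + (1 - D w) * a) < D w + (1 - D w) * b).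
    by move=> Dw a01; rewrite nextpt_rescaled // ltrD2l ltr_pM2l // subr_gt0.
  apply/seteqP; split => w.
    have := @future_set_closed01 w; rewrite /future_set /=; case: ifP => Dw c01 H.
      left; split => //=; have [|[a01 n]] := (closed01_hit a b c01).1 H; [by left|right].
      by rewrite -key.
    by right; split => //; rewrite /= /E /D /= Dw.
  move=> [[Dw /= H]|[Dw H]].
    apply/closed01_hit; first exact: future_set_closed01.
    rewrite /future_set ifT //; case: H => [|[a01]]; [by left|right].
    by rewrite key.
  by rewrite /= /future_set ifF //; apply/negP.
have mXab : measurable [set w | X w `&` `]a, b[ !=set0].
  apply: (measurable_funPTI X (Y := [set A | A `&` `]a, b[ !=set0])).
  by apply: measurable_hit; exact: itv_open.
apply: measurableU; apply: measurableI => //; last exact: measurableC.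
have mh c : measurable_fun setT (fun w => D w + (1 - D w) * c).
  by apply: measurable_funD => //; apply: measurable_funM => //; apply: measurable_funB.
have mn : measurable [set w | nextpt (X w) (D w + (1 - D w) * a) < D w + (1 - D w) * b].
  by apply: mlt => //; apply: measurable_nextpt_comp.
have [a01|na] := boolP (0 <= a < 1); last first.
  have [ab|nab] := boolP (a < 0 < b).
    by rewrite (_ : [set _ | _] = setT) // -subTset => w _; left.
  by rewrite (_ : [set _ | _] = set0) // -subset0 => w /= []; rewrite ?(negbTE na) ?(negbTE nab) // => -[].
rewrite (_ : [set _ | _] = [set w | nextpt (X w) (D w + (1 - D w) * a) < D w + (1 - D w) * b]) //.
apply/seteqP; split => w /=; last by right.
by case=> [/andP[a0 _]|[]//]; move: a01; rewrite leNgt a0.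
Qed.

Hypothesis Xregen : multiplicatively_regenerative X.

Let mlast (B : set R) : measurable B -> measurable [set A : hit_sets R | B (lastpt A)].
Proof.
move=> mB; rewrite -[X in measurable X]setTI.
exact: (@lastpt_measurable R measurableT B mB).
Qed.

(** [D] is [lastpt] of the past, so the independence of past and future together with the law of the
    future gives a product on [E]. *)
Lemma regen_prob_rectangle (A : set R) (B : set (hit_sets R)) :
  measurable A -> measurable B ->
  P ((fun w => (D w, future_set w)) @^-1` (A `*` B) `&` E) =
  (P (D @^-1` A `&` E) * P (X @^-1` B))%E.
Proof.
move=> mA mB; have [_ /(_ z z01) /=] := Xregen.
have Dz w : Dpoint (X w) z = D w by exact: DpointE.
have -> : [set w | Dpoint (X w) z < 1] = E by apply/seteqP; split => w /=; rewrite Dz.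
have mDA : measurable (D @^-1` A) by rewrite -[X in measurable X]setTI; apply: mD.
have mFB : measurable (future_set @^-1` B).
  by rewrite -[X in measurable X]setTI; apply: future_set_measurable.
have [PE0 _|PE /(_ isT)[Hind Hlaw]] := eqVneq (P E) 0%E.
  have z0 (S : set T) : measurable S -> P (S `&` E) = 0%E.
    move=> mS; apply/eqP; rewrite -measure_le0 -PE0 le_measure // inE //.
    exact: measurableI.
  rewrite !z0 ?mul0e //.
  rewrite (_ : _ @^-1` _ = D @^-1` A `&` future_set @^-1` B) //.
  exact: measurableI.
have := Hind B [set S | A (lastpt S)] mB (mlast mA).
have := Hlaw B mB.
rewrite (_ : [set w | A (lastpt _)] = D @^-1` A); last first.
  by apply/seteqP; split => w /=; rewrite Dz lastpt_past.
have PE0 : fine (P E) != 0 by apply: contra PE => /eqP PE0; rewrite -prob_fin // PE0.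
have fE : [set w | B (rescaled (X w) z)] `&` E = future_set @^-1` B `&` E.
  apply/seteqP; split => w [Bw Ew]; split => //; move: Bw;
    by rewrite /= /future_set -/(D w) Ew.
rewrite /condprob => ->.
rewrite (_ : [set w | B (rescaled (X w) z)] `&` D @^-1` A `&` E =
   (fun w => (D w, future_set w)) @^-1` (A `*` B) `&` E); last first.
  rewrite setIAC fE; apply/seteqP; split => w /=; [move=> [[? ?] ?]|move=> [[? ?] ?]]; by do ! split.
move/(congr1 (fun r => r * fine (P E))); rewrite divfK // mulrA divfK // => H.
have m1 : measurable ((fun w => (D w, future_set w)) @^-1` (A `*` B) `&` E).
  rewrite (_ : _ @^-1` _ = D @^-1` A `&` future_set @^-1` B) //.
  by apply: measurableI => //; exact: measurableI.
have m2 : measurable (D @^-1` A `&` E) by exact: measurableI.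
have m3 : measurable (X @^-1` B) by exact: measurable_funPTI.
by rewrite -(prob_fin P m1) -(prob_fin P m2) -(prob_fin P m3) -EFinM H mulrC.
Qed.

Local Open Scope ereal_scope.

(** On [E] the future may be replaced by an independent copy of [X]: the law of the pair agrees on
    rectangles with the product of the law of [D], restricted to []-oo, 1[], and the law of [X]. *)
Lemma regen_integral (F : R * hit_sets R -> \bar R) :
  measurable_fun setT F -> (forall p, 0 <= F p) ->
  \int[P]_(w in E) F (D w, future_set w) =
  \int[P]_(w in E) \int[P]_w' F (D w, X w').
Proof.
move=> mF F0.
have mg : measurable_fun setT (fun w => (D w, future_set w)).
  by apply: measurable_fun_pair => //; exact: future_set_measurable.
pose D' : {mfun T >-> R} := HB.pack D (isMeasurableFun.Build _ _ _ _ D mD).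
pose g : {mfun T >-> _} := HB.pack (fun w => (D w, future_set w)) (isMeasurableFun.Build _ _ _ _ _ mg).
have m1D : measurable (`]-oo, 1%R[ : set R) by exact: measurable_itv.
pose law := distribution P X.
pose mu := mrestr (distribution P D') m1D.
have EE : D @^-1` `]-oo, 1%R[ = E by apply/seteqP; split => w /=; rewrite in_itv.
transitivity (\int[pushforward (mrestr P mE) g]_p F p).
  rewrite ge0_integral_pushforward //= ge0_integral_mrestr //.
  exact: measurableT_comp.
transitivity (\int[(mu \x law)%E]_p F p).
  apply: eq_measure_integral => A mA _.
  apply/esym/product_measure_unique => // B C mB mC.
  rewrite /= /pushforward /mu /mrestr /distribution /pushforward.
  by rewrite preimage_setI EE; apply: regen_prob_rectangle.
rewrite fubini_tonelli1 //=.
rewrite /fubini_F ge0_integral_mrestr //.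
- rewrite ge0_integral_pushforward //.
  + rewrite EE; apply: eq_integral => w _ /=.
    rewrite ge0_integral_distribution //.
    exact: measurableT_comp.
  + apply: measurable_funTS; exact: measurable_fun_fubini_tonelli_F.
  + by move=> x _; apply: integral_ge0.
- exact: measurable_fun_fubini_tonelli_F.
- by move=> x; apply: integral_ge0.
Qed.

End Regeneration.

(** * Gap moments *)

Section LebesgueIntegral.
Variable R : realType.
Notation mu := (@lebesgue_measure R).
Local Open Scope ereal_scope.

(** The image of Lebesgue measure under the affine map, multiplied by [c], gives half-open intervals
    their length. *)
Lemma ge0_integral_affine (f : R -> \bar R) (s c : R) : (0 < c)%R ->
  measurable_fun setT f -> (forall x, 0 <= f x) ->
  \int[mu]_x f x = c%:E * \int[mu]_x f (s + c * x)%R.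
Proof.
move=> c0 mf f0.
have mh : measurable_fun setT (fun x : measurableTypeR R => (s + c * x)%R : measurableTypeR R).
  by apply: measurable_funD => //; apply: measurable_funM.
pose h (x : measurableTypeR R) : measurableTypeR R := (s + c * x)%R.
pose nu := mscale (NngNum (ltW c0)) (pushforward mu h) : {measure set (measurableTypeR R) -> \bar R}.
transitivity (\int[nu mh]_x f x).
  apply: eq_measure_integral => A mA _; apply: lebesgue_measure_unique => // _ [[a b]] /= _ <-.
  rewrite /nu /mscale /= /pushforward.
  rewrite (_ : _ @^-1` _ = `]((a - s) / c)%R, ((b - s) / c)%R]%classic); last first.
    apply/seteqP; split => x; rewrite /= !in_itv /= ltr_pdivrMr // ler_pdivlMr // ltrBlDl lerBrDl;
      by rewrite (mulrC x).
  rewrite !lebesgue_measure_itv /= !lte_fin ltr_pM2r ?invr_gt0 // ltrD2r.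
  case: ifP => ab; last by rewrite mule0.
  rewrite -!EFinB -EFinM; congr EFin; rewrite -mulrBl mulrC divfK ?gt_eqF //.
  lra.
rewrite /nu ge0_integral_mscale //=; congr (_ * _).
by rewrite ge0_integral_pushforward.
Qed.

Lemma integral_power (v D : R) (a : nat) : (v <= D)%R ->
  \int[mu]_(u in `[v, D[) ((D - u) ^+ a)%:E = ((D - v) ^+ a.+1 / a.+1%:R)%:E.
Proof.
rewrite le_eqVlt => /orP[/eqP <-|vD].
  by rewrite set_itvco0 integral_set0 subrr expr0n mul0r.
have mf : measurable_fun setT (fun u : R => ((D - u) ^+ a)%R).
  by apply: measurable_funX; apply: measurable_funB.
rewrite integral_itv_bndo_bndc; last first.
  by apply/measurable_EFinP; apply: measurable_funTS.
pose F (u : R) := (- ((D - u) ^+ a.+1 / a.+1%:R))%R.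
have dF (x : R) : is_derive x 1%R F ((D - x) ^+ a)%R.
  have -> : F = (- a.+1%:R^-1)%R \*: ((cst D - id) ^+ a.+1)%R.
    by apply/funext => u; rewrite /F /= fctE /GRing.scale /= mulNr [in RHS]mulrC.
  apply: is_derive_eq; rewrite /GRing.scale /= sub0r fctE.
  by field; rewrite addrC natr1 pnatr_eq0.
have cF (x : R) : {for x, continuous F}.
  by apply: differentiable_continuous; apply/derivable1_diffP; case: (dF x).
rewrite (@continuous_FTC2 _ _ F) //.
- by rewrite /F subrr expr0n mul0r oppr0 sub0e -EFinN opprK.
- apply: continuous_subspaceT => x.
  by apply: (@continuous_comp _ _ _ (fun u : R => (D - u)%R) (fun y => (y ^+ a)%R));
   [apply: cvgB; [exact: cvg_cst|exact: cvg_id]|exact: exprn_continuous].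
- split => [x _||]; first by case: (dF x).
  + by apply: cvg_at_right_filter; exact: cF.
  + by apply: cvg_at_left_filter; exact: cF.
- by move=> x _; rewrite derive1E; case: (dF x).
Qed.

End LebesgueIntegral.

(** * Gap integrals of a fixed set *)

Section GapFunction.
Variable R : realType.
Notation mu := (@lebesgue_measure R).

(** For independent uniform points, the probability that [a] given ones fall between [u] and its
    next point and [b] given ones beyond it. The value 0 outside [[0, 1[] lets integrals run over
    the whole line. *)
Definition gapfun a b (A : hit_sets R) (u : R) : R :=
  if 0 <= u < 1 then (nextpt A u - u) ^+ a * (1 - nextpt A u) ^+ b else 0.

Lemma gapfun_ge0 a b A u : 0 <= gapfun a b A u.
Proof.
rewrite /gapfun; case: ifP => // /andP[_ u1].
by rewrite mulr_ge0 // exprn_ge0 // subr_ge0 ?nextpt_ge ?nextpt_le1.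
Qed.

Lemma gapfun_le a b A u : gapfun a b A u <= \1_(`[0, 1[%classic : set R) u.
Proof.
rewrite /gapfun indicE; case: ifPn => [u01|_]; last by rewrite ler0n.
rewrite mem_set /= ?in_itv //; move/andP: u01 => [u0 u1].
have := nextpt_ge A u1; have := nextpt_le1 A u1 => n1 nu.
rewrite -[leRHS]mulr1 ler_pM // ?exprn_ge0 ?exprn_ile1 ?subr_ge0 //; lra.
Qed.

Lemma measurable_gapfun a b d (T : measurableType d) (f : T -> hit_sets R) (g : T -> R) :
  measurable_fun setT f -> measurable_fun setT g ->
  measurable_fun setT (fun x => gapfun a b (f x) (g x)).
Proof.
move=> mf mg; apply: measurable_fun_ifT => //.
  by apply: measurable_and; [exact: measurable_fun_ler|exact: measurable_fun_ltr].
have mn : measurable_fun setT (fun x => nextpt (f x) (g x)).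
  apply: (measurableT_comp (f := fun p : R * hit_sets R => nextpt p.2 p.1)
    (g := fun x => (g x, f x))); first exact: nextpt_measurable.
  exact: measurable_fun_pair.
by apply: measurable_funM; apply: measurable_funX; apply: measurable_funB.
Qed.

Lemma measurable_gapfun_r a b A : measurable_fun setT (gapfun a b A).
Proof. exact: measurable_gapfun. Qed.

Lemma gapfun_split a b A u :
  gapfun a b A u = gapfun a.+1 b A u + gapfun a b.+1 A u + u * gapfun a b A u.
Proof. by rewrite /gapfun; case: ifP => _; rewrite ?exprS; ring. Qed.

Local Open Scope ereal_scope.

Definition gap_integral a b (A : hit_sets R) := \int[mu]_u (gapfun a b A u)%:E.

Lemma gap_integral_ge0 a b A : 0 <= gap_integral a b A.
Proof. by apply: integral_ge0 => u _; rewrite lee_fin gapfun_ge0. Qed.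

Lemma integral_indic01 : \int[mu]_u (\1_(`[0, 1[%classic : set R) u)%:E = 1.
Proof.
rewrite integral_indic // setIT [LHS]lebesgue_measure_itv /= lte_fin ltr01.
by rewrite oppr0 adde0.
Qed.

Lemma gap_integral_le1 a b A : gap_integral a b A <= 1.
Proof.
rewrite -integral_indic01; apply: ge0_le_integral => //.
- by move=> u _; rewrite lee_fin gapfun_ge0.
- by apply/measurable_EFinP; apply: measurable_gapfun_r.
- by apply/measurable_EFinP; apply: measurable_indic.
- by move=> u _; rewrite lee_fin gapfun_le.
Qed.

Lemma gap_integral00 A : gap_integral 0 0 A = 1.
Proof.
rewrite -integral_indic01; apply: eq_integral => u _; congr EFin.
rewrite /gapfun indicE !expr0 mulr1; case: ifPn => u01.
  by rewrite mem_set //= in_itv.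
by rewrite memNset //= in_itv; apply/negP.
Qed.

Lemma measurable_gap_integral a b : measurable_fun setT (gap_integral a b).
Proof.
apply: (@measurable_fun_fubini_tonelli_F _ _ _ _ _ mu
   (fun p : hit_sets R * R => (gapfun a b p.1 p.2)%:E)).
  by apply/measurable_EFinP; apply: measurable_gapfun.
by move=> p; rewrite lee_fin gapfun_ge0.
Qed.

(* Cut at [nextpt A v]: on the left lies the rest of the gap of [v], on the right
   an affine copy of the rescaled set. *)
Lemma gap_integral_tail a b A v : is_closed01 A -> (0 <= v < 1)%R ->
  \int[mu]_(u in `[v, +oo[) (gapfun a b A u)%:E =
  (gapfun a.+1 b A v / a.+1%:R)%:E +
  (if (nextpt A v < 1)%R then (gapfun 0 (a + b).+1 A v)%:E * gap_integral a b (rescaled A v) else 0).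
Proof.
move=> A01 v01; have /andP[v0 v1] := v01; set D := nextpt A v.
have vD : (v <= D)%R by exact: nextpt_ge.
have D1 : (D <= 1)%R by exact: nextpt_le1.
have mgap S : measurable_fun S (fun u => (gapfun a b A u)%:E).
  by apply: measurable_funTS; apply/measurable_EFinP; exact: measurable_gapfun_r.
have gap0 u : 0 <= (gapfun a b A u)%:E by rewrite lee_fin gapfun_ge0.
have -> : `[v, +oo[%classic = `[v, D[%classic `|` `[D, +oo[%classic :> set R.
  by rewrite -itv_bndbnd_setU // ?bnd_simp.
rewrite ge0_integral_setU //; [|exact: mgap|]; last first.
  apply/disj_setPS => u []; rewrite /= !in_itv /= andbT => /andP[_ uD] Du.
  by move: uD; rewrite ltNge Du.
congr (_ + _).
  transitivity (\int[mu]_(u in `[v, D[) (((D - u) ^+ a)%:E * ((1 - D) ^+ b)%:E)).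
    apply: eq_integral => u; rewrite inE /= in_itv /= => /andP[vu uD].
    by rewrite /gapfun (nextpt_gap vu uD) (le_trans v0 vu) (lt_le_trans uD D1) EFinM.
  rewrite ge0_integralZr //; last 3 first.
  - apply: measurable_funTS; apply/measurable_EFinP; apply: measurable_funX.
    exact: measurable_funB.
  - move=> u; rewrite /= in_itv /= => /andP[_ uD].
    by rewrite lee_fin exprn_ge0 // subr_ge0 ltW.
  - by rewrite lee_fin exprn_ge0 // subr_ge0.
  by rewrite integral_power // -EFinM /gapfun v01 -/D mulrAC.
case: ifPn => [Dlt|]; last first.
  rewrite -leNgt => D1'; apply: integral0_eq => u; rewrite /= in_itv /= andbT => Du.
  by rewrite /gapfun ifF //; apply/negbTE; rewrite negb_and -!leNgt (le_trans D1' Du) orbT.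
have D0 : (0 < 1 - D)%R by rewrite subr_gt0.
(* One factor [1 - D] is the Jacobian and [a + b] more come from the scaled lengths, whence the
   exponent [(a + b).+1]. *)
rewrite integral_mkcond (@ge0_integral_affine _ _ D (1 - D)) //; last 2 first.
- by apply/(measurable_restrictT _ _).1.
- by move=> u; apply: erestrict_ge0.
rewrite /gapfun v01 expr0 mul1r -/D exprS EFinM -muleA; congr (_ * _).
rewrite -ge0_integralZl //; last 3 first.
- by apply/measurable_EFinP; apply: measurable_gapfun_r.
- by move=> u _; rewrite lee_fin gapfun_ge0.
- by rewrite lee_fin exprn_ge0 // ltW.
apply: eq_integral => x _; rewrite patchE /= mem_setE in_itv /= andbT.
rewrite -EFinM lerDl pmulr_rge0 // /gapfun.
have [x0|x0] := leP 0%R x; last by rewrite /= mulr0.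
have -> : (D + (1 - D) * x < 1)%R = (x < 1)%R.
  rewrite -[X in (_ < X)%R = _](_ : (D + (1 - D) * 1 = 1)%R); last first.
    by rewrite mulr1 addrC subrK.
  by rewrite ltrD2l ltr_pM2l.
rewrite (_ : (0 <= D + (1 - D) * x)%R); last first.
  by rewrite addr_ge0 // ?mulr_ge0 ?(le_trans v0 vD) // ltW.
rewrite /=.
case: ifPn => x1; last by rewrite mulr0.
congr EFin; rewrite nextpt_rescaled ?x0 //.
rewrite -/D exprD.
set N := nextpt _ x.
have -> : (D + (1 - D) * N - (D + (1 - D) * x) = (1 - D) * (N - x))%R by ring.
have -> : (1 - (D + (1 - D) * N) = (1 - D) * (1 - N))%R by ring.
by rewrite !exprMn; ring.
Qed.

End GapFunction.

(** * The recursion for expected gap integrals *)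

Section GapRecursion.
Context d (T : measurableType d) (R : realType) (P : probability T R).
Variable X : {RV P >-> hit_sets R}.
Notation mu := (@lebesgue_measure R).
Local Open Scope ereal_scope.

Definition expected_gap a b := \int[P]_w gap_integral a b (X w).

Let mX : measurable_fun setT (X : T -> hit_sets R).
Proof. exact: measurable_hit_rv. Qed.

Lemma measurable_gap_rv a b v : measurable_fun setT (fun w => (gapfun a b (X w) v)%:E).
Proof. by apply/measurable_EFinP; apply: measurable_gapfun. Qed.

Lemma measurable_gap_integral_rv a b : measurable_fun setT (fun w => gap_integral a b (X w)).
Proof. by apply: measurableT_comp; [exact: measurable_gap_integral|exact: mX]. Qed.

Lemma expected_gap_ge0 a b : 0 <= expected_gap a b.
Proof. by apply: integral_ge0 => w _; exact: gap_integral_ge0. Qed.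

Lemma expected_gap_fin a b : (fine (expected_gap a b))%:E = expected_gap a b.
Proof.
rewrite fineK // ge0_fin_numE ?expected_gap_ge0 //; apply: (@le_lt_trans _ _ 1); last exact: ltry.
rewrite -(probability_setT P) -[leRHS]mul1e -integral_cst //.
apply: ge0_le_integral => //.
- by move=> w _; exact: gap_integral_ge0.
- exact: measurable_gap_integral_rv.
- by move=> w _; exact: gap_integral_le1.
Qed.

Lemma expected_gap00 : expected_gap 0 0 = 1.
Proof.
rewrite /expected_gap; under eq_integral do rewrite gap_integral00.
by rewrite integral_cst //; apply: etrans (mul1e _) _; exact: probability_setT.
Qed.

Lemma expected_gap_swap a b :
  \int[mu]_v \int[P]_w (gapfun a b (X w) v)%:E = expected_gap a b.
Proof.
rewrite /expected_gap /gap_integral.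
apply: (@fubini_tonelli _ _ _ _ _ mu P (fun p : R * T => (gapfun a b (X p.2) p.1)%:E)).
  apply/measurable_EFinP; apply: measurable_gapfun => //.
  exact: measurableT_comp.
by move=> p; rewrite lee_fin gapfun_ge0.
Qed.

Hypothesis Xregen : multiplicatively_regenerative X.

Let X01 w : is_closed01 (X w). Proof. by case: Xregen => /(_ w). Qed.

(** Given that the next point of [v] is below 1, the rescaled set is an independent copy of [X], so
    its gap integral averages to the constant [expected_gap a b]. *)
Lemma expected_gap_tail a b (v : R) : (0 <= v < 1)%R ->
  \int[P]_w \int[mu]_(u in `[v, +oo[) (gapfun a b (X w) u)%:E =
  (a.+1%:R^-1)%:E * \int[P]_w (gapfun a.+1 b (X w) v)%:E +
  expected_gap a b * \int[P]_w (gapfun 0 (a + b).+1 (X w) v)%:E.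
Proof.
move=> v01; pose E := [set w | (nextpt (X w) v < 1)%R].
have mE : measurable E.
  rewrite -[X in measurable X]setTI.
  have mn : measurable_fun setT (fun w => nextpt (X w) v).
    by apply: measurable_nextpt_comp; exact: measurable_cst.
  have m1 : measurable_fun setT (fun _ : T => 1%R : R) by exact: measurable_cst.
  exact: (measurable_fun_ltr mn m1 measurableT (Y := [set true])).
have EP w : (w \in E) = (nextpt (X w) v < 1)%R by apply/idP/idP; rewrite inE.
pose W p := (gapfun 0 (a + b).+1 (X p) v)%:E.
transitivity (\int[P]_w ((a.+1%:R^-1)%:E * (gapfun a.+1 b (X w) v)%:E +
   ((fun w => W w * gap_integral a b (future_set X v w)) \_ E) w)).
  apply: eq_integral => w _; rewrite gap_integral_tail // patchE EP /future_set /W.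
  by rewrite EFinM [X in X + _]muleC; case: ifP.
have mFs : measurable_fun setT (fun w => gap_integral a b (future_set X v w)).
  apply: measurableT_comp; first exact: measurable_gap_integral.
  exact: (future_set_measurable X01 v01).
rewrite ge0_integralD //; last 4 first.
- by move=> w _; rewrite mule_ge0 // lee_fin ?gapfun_ge0.
- by apply: emeasurable_funM => //; exact: measurable_gap_rv.
- move=> w _; apply: erestrict_ge0 => w' _.
  by rewrite mule_ge0 ?lee_fin ?gapfun_ge0 ?gap_integral_ge0.
- apply/(measurable_restrictT _ _).1 => //; apply: measurable_funTS.
  by apply: emeasurable_funM => //; exact: measurable_gap_rv.
rewrite ge0_integralZl //; last 2 first.
- exact: measurable_gap_rv.
- by move=> w _; rewrite lee_fin gapfun_ge0.
congr (_ + _); rewrite -integral_mkcond.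
(* Truncation at 0 makes the integrand nonnegative for every real first argument, as
   [regen_integral] requires. *)
pose F (p : R * hit_sets R) := (Num.max 0 (1 - p.1) ^+ (a + b).+1)%:E * gap_integral a b p.2.
have D1 w : (nextpt (X w) v <= 1)%R by apply: nextpt_le1; case/andP: v01.
have WE w : W w = (Num.max 0 (1 - nextpt (X w) v) ^+ (a + b).+1)%:E.
  by rewrite /W /gapfun v01 expr0 mul1r max_r // subr_ge0.
transitivity (\int[P]_(w in E) F (nextpt (X w) v, future_set X v w)).
  by apply: eq_integral => w _; rewrite WE.
rewrite (regen_integral X01 v01 Xregen); last 2 first.
- apply: emeasurable_funM.
    apply/measurable_EFinP; apply: measurable_funX; apply: measurable_maxr => //.
    by apply: measurable_funB.
  by apply: measurableT_comp => //; exact: measurable_gap_integral.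
- by move=> p; rewrite mule_ge0 ?gap_integral_ge0 // lee_fin exprn_ge0 // le_max lexx.
transitivity (\int[P]_(w in E) (expected_gap a b * W w)).
  apply: eq_integral => w _; rewrite /F /= ge0_integralZl //.
  - by rewrite WE muleC.
  - exact: measurable_gap_integral_rv.
  - by move=> w' _; exact: gap_integral_ge0.
  - by rewrite lee_fin exprn_ge0 // le_max lexx.
rewrite ge0_integralZl //; last 3 first.
- by apply: measurable_funTS; exact: measurable_gap_rv.
- by move=> w _; rewrite lee_fin gapfun_ge0.
- exact: expected_gap_ge0.
congr (_ * _); rewrite integral_mkcond; apply: eq_integral => w _.
rewrite patchE EP; case: ifPn => //; rewrite -leNgt => Dw.
rewrite -/(W w) WE (_ : nextpt (X w) v = 1%R) ?subrr ?maxxx ?expr0n //.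
by apply: le_anti; rewrite D1 Dw.
Qed.

(* Write [u] as the integral of [v <= u] over [v], and use regeneration at [v]. *)
Lemma integral_gap_first_moment a b :
  \int[P]_w \int[mu]_u (u * gapfun a b (X w) u)%:E =
  (a.+1%:R^-1)%:E * expected_gap a.+1 b + expected_gap a b * expected_gap 0 (a + b).+1.
Proof.
pose k (p : (T * R) * R) : R :=
  if (0 <= p.1.2 <= p.2)%R then gapfun a b (X p.1.1) p.2 else 0%R.
have k0 p : 0 <= (k p)%:E by rewrite lee_fin /k; case: ifP => // _; exact: gapfun_ge0.
have mk : measurable_fun setT (fun p => (k p)%:E).
  apply/measurable_EFinP; apply: measurable_fun_ifT => //.
    by apply: measurable_and; apply: measurable_fun_ler => //; apply: measurableT_comp.
  by apply: measurable_gapfun => //; apply: measurableT_comp => //; apply: measurableT_comp.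
have kE w v : \int[mu]_u (k ((w, v), u))%:E =
   if (0 <= v < 1)%R then \int[mu]_(u in `[v, +oo[) (gapfun a b (X w) u)%:E else 0.
  case: ifPn => v01.
    rewrite [RHS]integral_mkcond; apply: eq_integral => u _.
    rewrite patchE mem_setE in_itv /= andbT /k /=.
    by case/andP: v01 => v0 _; rewrite v0 /=; case: (v <= u)%R.
  apply: integral0_eq => u _; rewrite /k /=; case: ifP => // /andP[v0 vu].
  rewrite /gapfun ifF //; move: v01; rewrite v0 /= -leNgt => v1.
  by apply/negbTE; rewrite negb_and -!leNgt (le_trans v1 vu) orbT.
transitivity (\int[P]_w \int[mu]_v \int[mu]_u (k ((w, v), u))%:E).
  apply: eq_integral => w _.
  rewrite (@fubini_tonelli _ _ _ _ _ mu mu (fun p : R * R => (k ((w, p.1), p.2))%:E)) //; last first.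
    by apply: (measurableT_comp mk); apply: measurable_fun_pair => //; apply: measurable_fun_pair.
  apply: eq_integral => u _ /=.
  transitivity (\int[mu]_(v in `[0%R, u]) (gapfun a b (X w) u)%:E); last first.
    rewrite [LHS]integral_mkcond; apply: eq_integral => v _.
    by rewrite patchE mem_setE in_itv /= /k /=; case: ifP.
  rewrite integral_cst // [X in _ * X]lebesgue_measure_itv /= lte_fin.
  case: ltgtP => u0; rewrite ?oppr0 ?adde0 ?mule0 //.
  - by rewrite mulrC EFinM.
  - by rewrite /gapfun [(0 <= u)%R]leNgt u0 /= mulr0.
  - by rewrite -u0 mul0r.
rewrite (@fubini_tonelli _ _ _ _ _ P mu (fun p : T * R => \int[mu]_u (k (p, u))%:E)); last 2 first.
- exact: (@measurable_fun_fubini_tonelli_F _ _ _ _ _ mu (fun p => (k p)%:E)).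
- by move=> p; apply: integral_ge0.
transitivity (\int[mu]_v ((a.+1%:R^-1)%:E * \int[P]_w (gapfun a.+1 b (X w) v)%:E +
  expected_gap a b * \int[P]_w (gapfun 0 (a + b).+1 (X w) v)%:E)).
  apply: eq_integral => v _ /=; have [v01|v01] := boolP (0 <= v < 1)%R.
    apply: etrans (expected_gap_tail a b v01); apply: eq_integral => w _.
    by apply: etrans (kE w v) _; rewrite v01.
  have z a' b' : \int[P]_w (gapfun a' b' (X w) v)%:E = 0.
    by apply: integral0_eq => w _; rewrite /gapfun (negbTE v01).
  rewrite !z !mule0 adde0; apply: integral0_eq => w _.
  by rewrite kE (negbTE v01).
have mi a' b' : measurable_fun setT (fun v => \int[P]_w (gapfun a' b' (X w) v)%:E).
  apply: (@measurable_fun_fubini_tonelli_F _ _ _ _ _ P (fun p : R * T => (gapfun a' b' (X p.2) p.1)%:E)).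
    by apply/measurable_EFinP; apply: measurable_gapfun => //; apply: measurableT_comp.
  by move=> p; rewrite lee_fin gapfun_ge0.
have i0 a' b' v : 0 <= \int[P]_w (gapfun a' b' (X w) v)%:E.
  by apply: integral_ge0 => w _; rewrite lee_fin gapfun_ge0.
rewrite ge0_integralD //; last 4 first.
- by move=> v _; rewrite mule_ge0 // lee_fin.
- by apply: emeasurable_funM; [exact: measurable_cst|exact: mi].
- by move=> v _; rewrite mule_ge0 ?expected_gap_ge0.
- by apply: emeasurable_funM; [exact: measurable_cst|exact: mi].
rewrite (@ge0_integralZl _ _ _ mu _ _ _ (mi a.+1 b)) // (@ge0_integralZl _ _ _ mu _ _ _ (mi 0%N (a + b).+1)) //.
  by rewrite !expected_gap_swap.
exact: expected_gap_ge0.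
Qed.

Lemma expected_gap_rec a b :
  expected_gap a b = expected_gap a.+1 b + expected_gap a b.+1 +
    ((a.+1%:R^-1)%:E * expected_gap a.+1 b + expected_gap a b * expected_gap 0 (a + b).+1).
Proof.
rewrite -integral_gap_first_moment.
have m1 a' b' w : measurable_fun setT (fun u => (gapfun a' b' (X w) u)%:E).
  by apply/measurable_EFinP; exact: measurable_gapfun_r.
have g0 a' b' w u : 0 <= (gapfun a' b' (X w) u)%:E by rewrite lee_fin gapfun_ge0.
have ug0 w u : 0 <= (u * gapfun a b (X w) u)%:E.
  rewrite lee_fin /gapfun; case: ifP => [/andP[u0 u1]|_]; last by rewrite mulr0.
  by rewrite mulr_ge0 // mulr_ge0 // exprn_ge0 // subr_ge0 ?nextpt_ge ?nextpt_le1.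
have mu1 w : measurable_fun setT (fun u : R => (u * gapfun a b (X w) u)%:E).
  by apply/measurable_EFinP; apply: measurable_funM => //; exact: measurable_gapfun_r.
transitivity (\int[P]_w (gap_integral a.+1 b (X w) + gap_integral a b.+1 (X w) +
    \int[mu]_u (u * gapfun a b (X w) u)%:E)).
  apply: eq_integral => w _; rewrite /gap_integral.
  rewrite -(@ge0_integralD _ _ _ mu _ measurableT _ _ (fun u _ => g0 _ _ w u)
    (m1 a.+1 b w) (fun u _ => g0 _ _ w u) (m1 a b.+1 w)).
  rewrite -ge0_integralD //; last 2 first.
  - by apply: emeasurable_funD; exact: m1.
  - exact: mu1.
    by apply: eq_integral => u _; rewrite -!EFinD -gapfun_split.
  by move=> u _; rewrite adde_ge0.
have mg a' b' := measurable_gap_integral_rv a' b'.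
have gi0 a' b' w := gap_integral_ge0 a' b' (X w).
rewrite ge0_integralD //; last 4 first.
- by move=> w _; rewrite adde_ge0.
- exact: emeasurable_funD.
- by move=> w _; apply: integral_ge0.
- apply: (@measurable_fun_fubini_tonelli_F _ _ _ _ _ mu (fun p : T * R => (p.2 * gapfun a b (X p.1) p.2)%:E)) => //.
  apply/measurable_EFinP; apply: measurable_funM => //.
  by apply: measurable_gapfun => //; exact: measurableT_comp.
by rewrite ge0_integralD.
Qed.

End GapRecursion.

(** Summing the recursion over [m] carries row sums upwards: the weights [m] and [N - m] add up to
    [N], and the term [q N 1] absent from the shifted sum is supplied by the last one. *)
Lemma decrement_matrix_of_rec (R : realFieldType) (q : nat -> nat -> R) :
  (forall n m, 0 <= q n m) -> q 1%N 1%N = 1 ->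
  (forall n m, (0 < m <= n)%N ->
     n.+1%:R * q n m = m.+1%:R * q n.+1 m.+1 + (n.+1 - m)%:R * q n.+1 m
                       + q n.+1 1%N * q n m) ->
  decrement_matrix q.
Proof.
move=> q0 q11 qrec; split => //.
elim=> [//|[|n] IH] _; first by rewrite big_nat1.
set N := n.+2.
have : \sum_(1 <= m < N) N%:R * q n.+1 m = \sum_(1 <= m < N)
    (m.+1%:R * q N m.+1 + (N - m)%:R * q N m + q N 1%N * q n.+1 m).
  by apply: eq_big_nat => m Hm; apply: qrec.
rewrite !big_split /= -!mulr_sumr IH // !mulr1.
have -> : \sum_(1 <= m < N) m.+1%:R * q N m.+1 = \sum_(1 <= m < N.+1) m%:R * q N m - q N 1%N.
  by rewrite [in RHS]big_nat_recl // mul1r addrC addKr.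
have -> : \sum_(1 <= m < N) (N - m)%:R * q N m = \sum_(1 <= m < N.+1) (N - m)%:R * q N m.
  by rewrite [in RHS]big_nat_recr //= subnn mul0r addr0.
rewrite addrAC subrK -big_split /=.
rewrite (eq_big_nat _ _ (F2 := fun m => N%:R * q N m)); last first.
  move=> m /andP[_ mN]; rewrite -mulrDl -natrD subnKC //.
by rewrite -mulr_sumr => /eqP; rewrite -[X in X == _]mulr1 => /eqP /mulfI <- //; rewrite pnatr_eq0.
Qed.

Section GapDecrement.
Context d (T : measurableType d) (R : realType) (P : probability T R).
Variable X : {RV P >-> hit_sets R}.
Hypothesis Xregen : multiplicatively_regenerative X.

Let g a b : R := fine (expected_gap X a b).

(* The probability that the leftmost block of an [n]-sample of uniform points
   classified by the gaps of [X] has size [m]. *)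
Definition gap_decrement (n m : nat) : R := (m * 'C(n, m))%:R * g m.-1 (n - m).

Let g_rec a b :
  g a b = g a.+1 b + g a b.+1 + (a.+1%:R^-1 * g a.+1 b + g a b * g 0 (a + b).+1).
Proof.
have gE a' b' : expected_gap X a' b' = (g a' b')%:E by rewrite /g expected_gap_fin.
have E := expected_gap_rec Xregen a b.
rewrite !gE -!EFinM -!EFinD in E; exact: (EFin_inj E).
Qed.

Lemma gap_decrement_matrix : decrement_matrix gap_decrement.
Proof.
apply: decrement_matrix_of_rec => [n m| |n m /andP[m0 mn]].
- by rewrite /gap_decrement mulr_ge0 // /g fine_ge0 ?expected_gap_ge0.
- by rewrite /gap_decrement /g expected_gap00 mulr1.
rewrite /gap_decrement; case: m m0 mn => // a _ an.
pose b := (n - a.+1)%N; have nab : n = (a + b).+1 by rewrite /b; lia.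
rewrite subn1 /= -/b.
have -> : (n.+1 - a.+2 = b)%N by rewrite /b; lia.
have -> : (n.+1 - a.+1 = b.+1)%N by rewrite /b; lia.
rewrite bin1 mul1n.
(* After division by [n.+1 * 'C(n, a.+1)], the coefficient of [g a.+1 b] is [a.+2], which is [a.+1]
   times [1 + a.+1%:R^-1]. *)
have E1 : (a.+2 * 'C(n.+1, a.+2) = n.+1 * 'C(n, a.+1))%N by rewrite mul_bin_diag.
have E2 : (b.+1 * 'C(n.+1, a.+1) = n.+1 * 'C(n, a.+1))%N.
  by rewrite mul_bin_down; congr muln; rewrite /b; lia.
rewrite E1 mulnC; rewrite [(b.+1)%:R * _]mulrA -natrM mulnCA E2.
rewrite {1}g_rec -nab !natrM.
have : a.+1%:R != 0 :> R by rewrite pnatr_eq0.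
rewrite -[a.+2%:R]natr1.
move: (g _ _) (g _ _) (g _ _) (g _ _) => x y z t a0.
by field.
Qed.

End GapDecrement.

(** Every [expected_gap a b] occurs in the decrement matrix, in row [(a + b).+1] and column [a.+1],
    with a nonzero factor. *)
Lemma expected_gap_unique d1 d2 (T1 : measurableType d1) (T2 : measurableType d2)
    (R : realType) (P1 : probability T1 R) (P2 : probability T2 R)
    (X1 : {RV P1 >-> hit_sets R}) (X2 : {RV P2 >-> hit_sets R}) :
  multiplicatively_regenerative X1 -> multiplicatively_regenerative X2 ->
  (forall n, (0 < n)%N -> expected_gap X1 n 0 = expected_gap X2 n 0) ->
  forall a b, expected_gap X1 a b = expected_gap X2 a b.
Proof.
move=> r1 r2 H a b; rewrite -[LHS]expected_gap_fin -[RHS]expected_gap_fin; congr EFin.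
have := decrement_unique (gap_decrement_matrix r1) (gap_decrement_matrix r2).
move=> /(_ _ (a + b).+1 a.+1); rewrite /gap_decrement /= subSS addKn => E.
have /mulfI : ((a.+1 * 'C((a + b).+1, a.+1))%:R : R) != 0.
  by rewrite pnatr_eq0 muln_eq0 /= -lt0n bin_gt0 ltnS leq_addr.
apply; apply: E; last by rewrite ltnS leq_addr.
by move=> n n1; rewrite subnn H // -ltnS prednK // ltnW.
Qed.

(** * Ranked lengths *)

Section RankedLengths.
Variable R : realType.
Notation mu := (@lebesgue_measure R).
Local Open Scope ereal_scope.

(** On a gap the integrand is the [n]-th power of the distance to the right end, so length [l]
    contributes [l ^+ n.+1 / n.+1]. The points of [A] that are limits from the right may have
    positive measure; [0 < n] makes the integrand vanish there. *)
Lemma ranked_lengths_power_sum (A : set R) (y : nat -> R) (n : nat) :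
  is_closed01 A -> is_ranked_lengths A y -> (0 < n)%N ->
  \sum_(0 <= j <oo) ((y j) ^+ n.+1)%:E = n.+1%:R%:E * gap_integral n 0 A.
Proof.
move=> A01 [y0 _ [f [fmem finj fsurj] fE]] n0.
pose C x := connected_component (`[0%R, 1%R] `\` A) x.
(* [u] may be the left end of its gap and thus a point of [A]; the midpoint is interior and
   identifies the component. *)
pose mid u : R := ((u + nextpt A u) / 2)%R.
(* The gap of length [y j] with its left endpoint; apart from these sets only
   points [u] with [nextpt A u = u] remain, where the integrand is [0]. *)
pose F j := [set u : R | [/\ (0 <= u < 1)%R, (u < nextpt A u)%R & f (C (mid u)) = j]].
have midgap u : (0 <= u < 1)%R -> (u < nextpt A u)%R ->
    [/\ (u < mid u < nextpt A u)%R, (0 <= mid u <= 1)%R & ~ A (mid u)].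
  move=> /andP[u0 u1] un; have n1 := nextpt_le1 A u1.
  have um : (u < mid u < nextpt A u)%R by rewrite /mid; lra.
  have m1 : (mid u <= 1)%R by lra.
  split => //; first by lra.
  by move/andP: um => [um mn]; exact: (nextpt_notin um m1 mn).
have FE j : (exists g d, [/\ (g <= d)%R, (d - g)%R = y j,
    F j = `[g, d[%classic & forall u, (g <= u < d)%R -> (0 <= u < 1)%R /\ nextpt A u = d]).
  have := y0 j; rewrite le_eqVlt => /orP[/eqP yj0|yj].
    (* An index with [y j = 0] numbers no component; [[0, 0[] is empty. *)
    exists 0%R, 0%R; split; rewrite ?lexx ?subrr //; last by move=> u; lra.
    rewrite set_itvco0 -subset0 => u [u01 un fj].
    have [um m01 nA] := midgap u u01 un.
    have : (0 < y j)%R.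
      by rewrite -fj; apply: fmem; exists (mid u) => //; split => //; rewrite /= in_itv.
    by rewrite -yj0 ltxx.
  have [_ [x [x01 nAx] <-] fIj] := fsurj j yj.
  have x01' : (0 <= x <= 1)%R by move: x01; rewrite /= in_itv.
  have [g [Ag /andP[g0 gd] gxd CE gap]] := component_gap A01 x01' nAx.
  have x1 : (x < 1)%R.
    rewrite lt_neqAle; case/andP: x01' => _ ->; rewrite andbT.
    by apply/eqP => x1; apply: nAx; rewrite x1; case: A01.
  have d1 := nextpt_le1 A x1; set d := nextpt A x in gd gxd CE gap d1 *.
  exists g, d; split; [exact: ltW| | |].
  - rewrite -fIj fE; last by exists x.
    by rewrite CE [X in fine X]lebesgue_measure_itv /= lte_fin gd.
  - apply/seteqP; split => u.
      move=> [u01 un fj]; have [/andP[um mn] m01 nA] := midgap u u01 un.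
      have Cm : C (mid u) = C x.
        apply: finj; rewrite ?inE; [by exists (mid u) => //; split => //; rewrite /= in_itv|by exists x|].
        by rewrite fj.
      have : C x (mid u).
        by rewrite -Cm; apply: connected_component_refl; split => //; rewrite /= in_itv.
      rewrite /C CE /= in_itv /= => /andP[gm md].
      have nd : nextpt A u = d by rewrite -(nextpt_gap (ltW um) mn) gap // (ltW gm) md.
      rewrite in_itv /=; apply/andP; split; last by rewrite -nd.
      rewrite leNgt; apply/negP => ug.
      by apply: (nextpt_notin ug _ _ Ag); [rewrite (le_trans (ltW gd))|rewrite nd].
    rewrite /= in_itv /= => gud; have nd := gap u gud; move/andP: gud => [gu ud].
    have u01 : (0 <= u < 1)%R by rewrite (le_trans g0 gu) (lt_le_trans ud).
    have un : (u < nextpt A u)%R by rewrite nd.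
    split => //; rewrite -fIj; congr f; have [um m01 nA] := midgap u u01 un.
    apply/esym/same_connected_component; rewrite CE /= in_itv /=.
    by move: um; rewrite nd => /andP[um ->]; rewrite (le_lt_trans gu um).
  - move=> u gud; split; last exact: gap.
    by move/andP: gud => [gu ud]; rewrite (le_trans g0 gu) (lt_le_trans ud).
have gm : measurable_fun setT (fun u => (gapfun n 0 A u)%:E).
  by apply/measurable_EFinP; exact: measurable_gapfun_r.
have mF j : measurable (F j) by have [g [d [_ _ -> _]]] := FE j; exact: measurable_itv.
have Fpow j : \int[mu]_(u in F j) (gapfun n 0 A u)%:E = ((y j) ^+ n.+1 / n.+1%:R)%:E.
  have [g [d [gd <- -> gap]]] := FE j; rewrite -integral_power //.
  apply: eq_integral => u; rewrite inE /= in_itv /= => /gap[u01 nd].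
  by rewrite /gapfun u01 nd expr0 mulr1.
have -> : gap_integral n 0 A = \int[mu]_(u in \bigcup_j F j) (gapfun n 0 A u)%:E.
  rewrite [RHS]integral_mkcond; apply: eq_integral => u _; rewrite patchE.
  case: ifPn => //; rewrite notin_setE => nF; rewrite /gapfun; case: ifPn => // u01.
  have /andP[u0 u1] := u01.
  have := nextpt_ge A u1; rewrite le_eqVlt => /orP[/eqP <-|un].
    by rewrite subrr expr0n eqn0Ngt n0 mul0r.
  by exfalso; apply: nF; exists (f (C (mid u))).
rewrite ge0_integral_bigcup //; last 3 first.
- exact: measurable_funTS.
- by move=> u _; rewrite lee_fin gapfun_ge0.
- by apply/trivIsetP => i j _ _ ij; rewrite -subset0 => u [[_ _ fi] [_ _ fj]]; move/eqP: ij; rewrite -fi -fj.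
rewrite -nneseriesZl; last by move=> j _; apply: integral_ge0 => u _; rewrite lee_fin gapfun_ge0.
apply: eq_eseriesr => j _; rewrite Fpow -EFinM mulrC divfK // pnatr_eq0.
Qed.

End RankedLengths.

Section RankedLengthsLaw.
Context d1 d2 (T1 : measurableType d1) (T2 : measurableType d2) (R : realType).
Context (P1 : probability T1 R) (P2 : probability T2 R).
Context (X : {RV P1 >-> hit_sets R}) (Y : {RV P2 >-> real_seqs R}).
Local Open Scope ereal_scope.

Lemma expected_gap_ranked_lengths (n : nat) :
  (forall w, is_closed01 (X w)) -> ranked_lengths_distributed_like X Y -> (0 < n)%N ->
  n.+1%:R%:E * expected_gap X n 0 =
  \int[distribution P2 Y]_y \sum_(0 <= j <oo) (Num.max 0 (y j) ^+ n.+1)%:E.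
Proof.
move=> X01 [L LX LY] n0.
(* The maximum with 0 makes the power sum nonnegative on all sequences and leaves ranked lengths
   unchanged. *)
pose S (y : real_seqs R) := \sum_(0 <= j <oo) (Num.max 0 (y j) ^+ n.+1)%:E.
have mcoord j : measurable_fun setT (fun y : real_seqs R => y j).
  move=> _ U mU; rewrite setTI; apply: sub_sigma_algebra; exists j, U.
  by split.
have S0 y : 0 <= S y.
  by apply: nneseries_ge0 => j _ _; rewrite lee_fin exprn_ge0 // le_max lexx.
have mS : measurable_fun setT S.
  apply: ge0_emeasurable_sum => [j y _ _|j _].
    by rewrite lee_fin exprn_ge0 // le_max lexx.
  by apply/measurable_EFinP; apply: measurable_funX; apply: measurable_maxr.
transitivity (\int[distribution P1 L]_y S y); last by apply: eq_measure_integral => A mA _; exact: LY.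
rewrite ge0_integral_distribution // /expected_gap -ge0_integralZl //; last 2 first.
- exact: measurable_gap_integral_rv.
- by move=> w _; exact: gap_integral_ge0.
apply: eq_integral => w _; rewrite -(ranked_lengths_power_sum (X01 w) (LX w) n0) /= /S.
have [L0 _ _] := LX w.
by apply: eq_eseriesr => j _; rewrite max_r.
Qed.

End RankedLengthsLaw.

(** * A moment problem *)

Section Steep.
Variable R : realType.
Implicit Types (x y t r : R).

Lemma natmul_expr_cvg0 r : 0 <= r < 1 -> (fun k => k%:R * r ^+ k) @ \oo --> (0 : R).
Proof.
(* Since [r <= s ^+ 2] with [s < 1], one factor [s ^+ k] absorbs [k] by Bernoulli's inequality and
   the other tends to 0. *)
move=> /andP[r0 r1]; pose s := (1 + r) / 2.
have s01 : 0 < s < 1 by rewrite /s; lra.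
have /andP[s0 s1] := s01; pose h := s^-1 - 1.
have h0 : 0 < h by rewrite subr_gt0 invf_gt1.
have rs : r <= s ^+ 2.
  by rewrite -subr_ge0 (_ : s ^+ 2 - r = ((1 - r) / 2) ^+ 2) ?sqr_ge0 // /s; field.
have bern k : 1 + k%:R * h <= (1 + h) ^+ k.
  elim: k => [|k IH]; first by rewrite mul0r addr0 expr0.
  rewrite exprS; apply: le_trans (_ : (1 + h) * (1 + k%:R * h) <= _).
    rewrite -natr1 -subr_ge0 (_ : _ - _ = k%:R * h ^+ 2); last by ring.
    by rewrite mulr_ge0 // sqr_ge0.
  by rewrite ler_pM2l // addr_gt0.
have ks k : k%:R * s ^+ k <= h^-1.
  have hs : 1 + h = s^-1 by rewrite /h addrC subrK.
  have sk0 : 0 < s ^+ k by rewrite exprn_gt0.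
  rewrite -[leRHS]mul1r ler_pdivlMr // mulrAC -ler_pdivlMr // mul1r -exprVn -hs.
  by apply: le_trans (bern k); rewrite lerDr.
apply: (@squeeze_cvgr _ _ _ _ (fun=> 0) (fun k => h^-1 * s ^+ k)).
- apply: nearW => k; rewrite mulr_ge0 ?exprn_ge0 //=.
  apply: (@le_trans _ _ (k%:R * (s ^+ 2) ^+ k)).
    by rewrite ler_wpM2l // lerXn2r // nnegrE ?sqr_ge0.
  rewrite -exprM mulnC exprM expr2 mulrA.
  by rewrite ler_wpM2r ?ks // exprn_ge0 // ltW.
- exact: cvg_cst.
- rewrite -[X in _ --> X](mulr0 h^-1); apply: cvgM; first exact: cvg_cst.
  by apply: cvg_expr; rewrite ger0_norm // ltW.
Qed.

Lemma expr1B_ge y (m : nat) : 0 <= y <= 1 -> 1 - m%:R * y <= (1 - y) ^+ m.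
Proof.
move=> /andP[y0 y1]; elim: m => [|m IH]; first by rewrite mul0r subr0 expr0.
rewrite exprS; apply: le_trans (_ : (1 - y) * (1 - m%:R * y) <= _).
  rewrite -natr1 -subr_ge0 (_ : _ - _ = m%:R * y ^+ 2); last by ring.
  by rewrite mulr_ge0 // sqr_ge0.
by rewrite ler_wpM2l // subr_ge0.
Qed.

Lemma expr1B_le y (m : nat) : 0 <= y <= 1 -> (1 - y) ^+ m * (1 + m%:R * y) <= 1.
Proof.
move=> /andP[y0 y1]; elim: m => [|m IH]; first by rewrite expr0 mul0r addr0 mulr1.
apply: le_trans IH; rewrite exprSr -mulrA ler_wpM2l ?exprn_ge0 ?subr_ge0 //.
rewrite -natr1 -subr_ge0 (_ : _ - _ = (m%:R + 1) * y ^+ 2); last by ring.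
by rewrite mulr_ge0 ?sqr_ge0 ?addr_ge0.
Qed.

(* The polynomials [(1 - x ^+ k) ^+ steep_exponent t k] tend to the indicator of
   [x < t] on [0, 1], so Weierstrass' theorem is not needed. *)
Definition steep_exponent t (k : nat) : nat := (k * (Num.truncn (t^-1 ^+ k)).+1)%N.

Lemma steep_cvg t x : 0 < t <= 1 -> 0 <= x <= 1 ->
  (fun k => (1 - x ^+ k) ^+ steep_exponent t k) @ \oo --> ((x < t)%R%:R : R).
Proof.
move=> /andP[t0 t1] /andP[x0 x1].
have t'0 : 0 < t^-1 by rewrite invr_gt0.
have xk k : 0 <= x ^+ k <= 1 by rewrite exprn_ge0 //= exprn_ile1.
have sk0 k : 0 <= (1 - x ^+ k) ^+ steep_exponent t k.
  by rewrite exprn_ge0 // subr_ge0; case/andP: (xk k).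
have [xt|tx] := ltP x t.
  have r01 : 0 <= x / t < 1 by rewrite divr_ge0 ?(ltW t0) //= ltr_pdivrMr // mul1r.
  (* By Bernoulli the distance to 1 is at most the exponent times [x ^+ k], and the exponent is at
     most [k * (t^-1 ^+ k + 1)]. *)
  apply: (@squeeze_cvgr _ _ _ _ (fun k => 1 - 2 * (k%:R * (x / t) ^+ k)) (fun=> 1)).
  - apply: nearW => k; rewrite exprn_ile1 ?subr_ge0 ?gerBl; try by case/andP: (xk k).
    rewrite andbT; apply: le_trans (expr1B_ge _ (xk k)).
    rewrite lerD2l lerN2 /steep_exponent natrM -mulrA [leRHS]mulrCA ler_wpM2l //.
    have := truncn_le (t^-1 ^+ k); rewrite exprn_ge0 ?(ltW t'0) // => H.
    have xr : x ^+ k <= (x / t) ^+ k.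
      rewrite lerXn2r // ?nnegrE //; first by case/andP: r01.
      by rewrite ler_pdivlMr // ler_piMr.
    rewrite -natr1 mulrDl mul1r mulrDl mul1r lerD // expr_div_n -exprVn mulrC.
    by rewrite ler_wpM2l //; case/andP: (xk k).
  - rewrite -[X in _ --> X]subr0; apply: cvgB; first exact: cvg_cst.
    rewrite -[X in _ --> X](mulr0 2); apply: cvgM; first exact: cvg_cst.
    exact: natmul_expr_cvg0.
  - exact: cvg_cst.
(* The factor [k] in the exponent makes its product with [x ^+ k] at least [k] even at [x = t], so
   the limit there is 0. *)
apply: (@squeeze_cvgr _ _ _ _ (fun=> 0) (fun k => k.+1%:R^-1)).
- apply: nearW => k; rewrite sk0 /=.
  have := expr1B_le (steep_exponent t k) (xk k).
  have kle : k%:R <= (steep_exponent t k)%:R * x ^+ k.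
    rewrite /steep_exponent natrM -mulrA ler_peMr //.
    apply: (@le_trans _ _ (t^-1 ^+ k * x ^+ k)).
      by rewrite -exprMn exprn_ege1 // mulrC ler_pdivlMr // mul1r.
    by rewrite ler_wpM2r ?(ltW (truncnS_gt _)) //; case/andP: (xk k).
  have k1 : 0 < k.+1%:R :> R by rewrite ltr0n.
  rewrite -[X in _ -> _ <= X]mul1r ler_pdivlMr //; apply: le_trans.
  by rewrite ler_wpM2l // -natr1 addrC lerD2l.
- exact: cvg_cst.
- exact: cvg_harmonic.
Qed.

End Steep.

Section MomentTail.
Local Open Scope ereal_scope.

Definition tail_moment d (T : measurableType d) (R : realType) (m : {measure set T -> \bar R})
    (f g : T -> R) (n k l : nat) :=
  \int[m]_x (f x ^+ n * (1 - f x ^+ k) ^+ l * g x)%:E.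

Section OneMeasure.
Context d (T : measurableType d) (R : realType) (m : {measure set T -> \bar R}).
Variables f g : T -> R.
Hypotheses (mf : measurable_fun setT f) (mg : measurable_fun setT g).
Hypotheses (f01 : forall x, (0 <= f x <= 1)%R) (g0 : forall x, (0 <= g x)%R).
Hypothesis gfin : \int[m]_x (g x)%:E < +oo.

Let J := tail_moment m f g.

Let fk k x : (0 <= f x ^+ k <= 1)%R.
Proof. by case/andP: (f01 x) => f0 f1; rewrite exprn_ge0 //= exprn_ile1. Qed.

Let h01 n k l x : (0 <= f x ^+ n * (1 - f x ^+ k) ^+ l <= 1)%R.
Proof.
have /andP[a0 a1] := fk n x; have /andP[b0 b1] := fk k x.
have c01 : (0 <= (1 - f x ^+ k) ^+ l <= 1)%R by rewrite exprn_ge0 ?exprn_ile1 //; lra.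
by case/andP: c01 => c0 c1; rewrite mulr_ge0 //= -[leRHS]mulr1 ler_pM.
Qed.

Let mh n k l : measurable_fun setT (fun x => (f x ^+ n * (1 - f x ^+ k) ^+ l * g x)%:E).
Proof.
apply/measurable_EFinP; apply: measurable_funM => //; apply: measurable_funM.
  exact: measurable_funX.
by apply: measurable_funX; apply: measurable_funB => //; exact: measurable_funX.
Qed.

Let h0 n k l x : 0 <= (f x ^+ n * (1 - f x ^+ k) ^+ l * g x)%:E.
Proof. by rewrite lee_fin mulr_ge0 //; case/andP: (h01 n k l x). Qed.

Lemma tail_moment_fin n k l : J n k l \is a fin_num.
Proof.
rewrite ge0_fin_numE; last by apply: integral_ge0.
apply: le_lt_trans gfin; apply: ge0_le_integral => //.
- by apply/measurable_EFinP.
- by move=> x _; rewrite lee_fin ler_piMl //; case/andP: (h01 n k l x).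
Qed.

(** Solved for the term with [l.+1], this reduces everything to [l = 0], the plain moments;
    finiteness permits the subtraction. *)
Lemma tail_moment_rec n k l : J n k l = J n k l.+1 + J (n + k) k l.
Proof.
rewrite /J /tail_moment -ge0_integralD //; apply: eq_integral => x _.
by rewrite -EFinD exprD exprS; congr EFin; ring.
Qed.

Lemma tail_moment_cvg t : (0 < t <= 1)%R ->
  J 0 k (steep_exponent t k) @[k --> \oo] --> \int[m]_x ((f x < t)%R%:R * g x)%:E.
Proof.
move=> t01; apply: (@dominated_cvg _ _ _ m setT measurableT
  (fun k x => (f x ^+ 0 * (1 - f x ^+ k) ^+ steep_exponent t k * g x)%:E)
  _ (fun x => (g x)%:E)) => //.
- move=> x _; apply: cvg_EFin; first exact: nearW.
  apply: cvgM; last exact: cvg_cst.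
  rewrite (_ : (fun k => _) = (fun k => ((1 - f x ^+ k) ^+ steep_exponent t k)%R)).
    exact: steep_cvg.
  by apply/funext => k; rewrite expr0 mul1r.
- apply/integrableP; split; first exact/measurable_EFinP.
  by under eq_integral => x _ do rewrite gee0_abs ?lee_fin //.
- move=> k x _; rewrite gee0_abs // lee_fin ler_piMl //.
  by case/andP: (h01 0 k (steep_exponent t k) x).
Qed.

End OneMeasure.

(** The weight [g] allows two successive applications, one for each variable of the pair formed by
    [u] and its next point. *)
Lemma tail_moment_unique d1 d2 (T1 : measurableType d1) (T2 : measurableType d2) (R : realType)
    (m1 : {measure set T1 -> \bar R}) (m2 : {measure set T2 -> \bar R})
    (f1 g1 : T1 -> R) (f2 g2 : T2 -> R) (t : R) :
  measurable_fun setT f1 -> measurable_fun setT g1 ->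
  measurable_fun setT f2 -> measurable_fun setT g2 ->
  (forall x, 0 <= f1 x <= 1)%R -> (forall x, 0 <= g1 x)%R ->
  (forall x, 0 <= f2 x <= 1)%R -> (forall x, 0 <= g2 x)%R ->
  \int[m1]_x (g1 x)%:E < +oo ->
  (forall n, \int[m1]_x (f1 x ^+ n * g1 x)%:E = \int[m2]_x (f2 x ^+ n * g2 x)%:E) ->
  \int[m1]_x ((f1 x < t)%R%:R * g1 x)%:E = \int[m2]_x ((f2 x < t)%R%:R * g2 x)%:E.
Proof.
move=> mf1 mg1 mf2 mg2 f01 g01 f02 g02 fin1 H.
have gE : \int[m1]_x (g1 x)%:E = \int[m2]_x (g2 x)%:E.
  have := H 0%N; under eq_integral do rewrite expr0 mul1r.
  by under [in X in _ = X -> _]eq_integral do rewrite expr0 mul1r.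
have fin2 : \int[m2]_x (g2 x)%:E < +oo by rewrite -gE.
have [t0|t0] := leP t 0%R.
  rewrite !integral0_eq // => x _.
    by rewrite ltNge (le_trans t0) ?mul0r //; case/andP: (f02 x).
  by rewrite ltNge (le_trans t0) ?mul0r //; case/andP: (f01 x).
have [t1|t1] := leP t 1%R; last first.
  transitivity (\int[m1]_x (g1 x)%:E).
    apply: eq_integral => x _; rewrite (le_lt_trans _ t1) ?mul1r //.
    by case/andP: (f01 x).
  rewrite gE; apply: eq_integral => x _; rewrite (le_lt_trans _ t1) ?mul1r //.
  by case/andP: (f02 x).
have J12 l : forall n k, tail_moment m1 f1 g1 n k l = tail_moment m2 f2 g2 n k l.
  elim: l => [|l IH] n k.
    rewrite /tail_moment; under eq_integral do rewrite expr0 mulr1.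
    by under [in RHS]eq_integral do rewrite expr0 mulr1.
  have [F1 F2] := (tail_moment_fin mf1 mg1 f01 g01 fin1 (n + k) k l,
    tail_moment_fin mf2 mg2 f02 g02 fin2 (n + k) k l).
  rewrite -(addeK (tail_moment m1 f1 g1 n k l.+1) F1) -(addeK (tail_moment m2 f2 g2 n k l.+1) F2).
  by rewrite -(tail_moment_rec m1) // -(tail_moment_rec m2) // !IH.
have t01 : (0 < t <= 1)%R by rewrite t0.
have := tail_moment_cvg mf1 mg1 f01 g01 fin1 t01.
have := tail_moment_cvg mf2 mg2 f02 g02 fin2 t01.
rewrite (_ : (fun k => tail_moment m1 _ _ _ _ _) =
  (fun k => tail_moment m2 f2 g2 0 k (steep_exponent t k))); last by apply/funext => k; exact: J12.
by move=> c2 c1; apply: (cvg_unique _ c1 c2).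
Qed.

End MomentTail.

(** * The law of the next point *)

Section NextPointTail.
Context d (T : measurableType d) (R : realType) (P : probability T R).
Variable X : {RV P >-> hit_sets R}.
Notation mu := (@lebesgue_measure R).

Definition room (u : R) : R := if 0 <= u < 1 then 1 - u else 0.

Lemma room01 u : 0 <= room u <= 1.
Proof. by rewrite /room; case: ifP => [/andP[u0 u1]|_]; lra. Qed.

Lemma room_measurable : measurable_fun setT room.
Proof.
apply: measurable_fun_ifT => //; last exact: measurable_funB.
by apply: measurable_and; [exact: measurable_fun_ler|exact: measurable_fun_ltr].
Qed.

Let mgap a b : measurable_fun setT (fun p : T * R => gapfun a b (X p.1) p.2).
Proof.
apply: measurable_gapfun => //; apply: measurableT_comp => //; exact: measurable_hit_rv.
Qed.

Let mroom : measurable_fun setT (fun p : T * R => room p.2).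
Proof. by apply: measurableT_comp => //; exact: room_measurable. Qed.

Local Open Scope ereal_scope.

Definition room_moment n a b :=
  \int[P \x mu]_p (room p.2 ^+ n * gapfun a b (X p.1) p.2)%:E.

Let pos n a b p : 0 <= (room p.2 ^+ n * gapfun a b (X p.1) p.2)%:E.
Proof.
by rewrite lee_fin mulr_ge0 ?gapfun_ge0 // exprn_ge0 //; case/andP: (room01 p.2).
Qed.

Let mpos n a b :
  measurable_fun setT (fun p : T * R => (room p.2 ^+ n * gapfun a b (X p.1) p.2)%:E).
Proof. by apply/measurable_EFinP; apply: measurable_funM => //; exact: measurable_funX. Qed.

Lemma room_moment0 a b : room_moment 0 a b = expected_gap X a b.
Proof.
apply: etrans (@fubini_tonelli1 _ _ _ _ _ P mu _ (mpos 0 a b) (pos 0 a b)) _.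
apply: eq_integral => w _; rewrite /fubini_F /=.
by apply: eq_integral => u _; rewrite expr0 mul1r.
Qed.

(** On [[0, 1[], [1 - u] is the distance to the next point plus the distance from there to 1. All
    moments with powers of [room] thus reduce to expected gap integrals. *)
Lemma room_momentS n a b : room_moment n.+1 a b = room_moment n a.+1 b + room_moment n a b.+1.
Proof.
rewrite /room_moment -(@ge0_integralD _ _ _ (P \x mu) _ measurableT _ _
  (fun p _ => pos n a.+1 b p) (mpos n a.+1 b) (fun p _ => pos n a b.+1 p) (mpos n a b.+1)).
apply: eq_integral => -[w u] _.
rewrite -EFinD; congr EFin; rewrite /= /room /gapfun; case: ifP => _; last first.
  by rewrite !mulr0 addr0.
by rewrite !exprS; ring.
Qed.

(** On [[0, 1[] the two tests say that the next point exceeds [1 - s] and that [u] exceeds [1 - t];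
    [gapfun 0 0] is the indicator of [[0, 1[]. *)
Definition tail_integral (s t : R) :=
  \int[P \x mu]_p ((gapfun 0 1 (X p.1) p.2 < s)%R%:R *
     ((room p.2 < t)%R%:R * gapfun 0 0 (X p.1) p.2))%:E.

Definition nextpt_tail (y u : R) := P [set w | (y < nextpt (X w) u)%R].

Lemma measurable_nextpt_gt y u : measurable [set w | (y < nextpt (X w) u)%R].
Proof.
rewrite -[X in measurable X]setTI.
have mn : measurable_fun setT (fun w => nextpt (X w) u).
  by apply: measurable_nextpt_comp; exact: measurable_cst.
have m1 : measurable_fun setT (fun _ : T => y) by exact: measurable_cst.
exact: (measurable_fun_ltr m1 mn measurableT (Y := [set true])).
Qed.

Lemma measurable_nextpt_tail y : measurable_fun setT (nextpt_tail y).
Proof.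
pose S := [set p : R * T | (y < nextpt (X p.2) p.1)%R].
have mS : measurable S.
  rewrite -[X in measurable X]setTI.
  have mn : measurable_fun setT (fun p : R * T => nextpt (X p.2) p.1).
    apply: (measurableT_comp (f := fun p : R * hit_sets R => nextpt p.2 p.1)
      (g := fun p : R * T => (p.1, X p.2))); first exact: nextpt_measurable.
    apply: measurable_fun_pair => //.
    by apply: measurableT_comp => //; exact: measurable_hit_rv.
  have m1 : measurable_fun setT (fun _ : R * T => y) by exact: measurable_cst.
  exact: (measurable_fun_ltr m1 mn measurableT (Y := [set true])).
rewrite (_ : nextpt_tail y = P \o xsection S).
  exact: measurable_fun_xsection.
apply/funext => u /=; rewrite /nextpt_tail; congr (P _).
by apply/seteqP; split => w; rewrite /xsection /= inE.
Qed.

Let ind (p : T * R) s t : R := ((gapfun 0 1 (X p.1) p.2 < s)%R%:R *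
     ((room p.2 < t)%R%:R * gapfun 0 0 (X p.1) p.2))%R.

Let mlt (f : T * R -> R) (s : R) : measurable_fun setT f ->
  measurable_fun setT (fun p => (f p < s)%R%:R : R).
Proof.
move=> mf; rewrite (_ : (fun p => _) = (fun p => if (f p < s)%R then 1%R else 0%R)).
  apply: measurable_fun_ifT => //; apply: measurable_fun_ltr => //; exact: measurable_cst.
by apply/funext => p; case: ifP.
Qed.

Let mind s t : measurable_fun setT (fun p => (ind p s t)%:E).
Proof. by apply/measurable_EFinP; do ! apply: measurable_funM => //; exact: mlt. Qed.

Let ind0 s t p : 0 <= (ind p s t)%:E.
Proof. by rewrite lee_fin !mulr_ge0 // gapfun_ge0. Qed.

Lemma tail_integralE s t : (t <= 1)%R ->
  tail_integral s t = \int[mu]_(u in `](1 - t)%R, 1%R[) nextpt_tail (1 - s)%R u.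
Proof.
move=> t1; apply: etrans (@fubini_tonelli1 _ _ _ _ _ P mu _ (mind s t) (ind0 s t)) _.
apply: etrans (@fubini_tonelli _ _ _ _ _ P mu _ (mind s t) (ind0 s t)) _.
rewrite [RHS]integral_mkcond; apply: eq_integral => u _; rewrite patchE.
have [utl|utl] := boolP (1 - t < u < 1)%R; last first.
  rewrite memNset; last by rewrite /= in_itv /=; apply/negP.
  apply: integral0_eq => w _; rewrite /ind /= /gapfun /room.
  case: ifPn => [/andP[u0 u1]|]; last by rewrite !mulr0.
  by rewrite (_ : (1 - u < t)%R = false) ?mul0r ?mulr0 //; apply/negP => ut; case/negP: utl; lra.
rewrite mem_set; last by rewrite /= in_itv.
have u01 : (0 <= u < 1)%R by lra.
rewrite /nextpt_tail -[P _]mul1e.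
have mS := measurable_nextpt_gt (1 - s)%R u.
transitivity (\int[P]_(w in [set w | (1 - s < nextpt (X w) u)%R]) (cst 1 w)).
  rewrite [RHS]integral_mkcond; apply: eq_integral => w _; rewrite patchE.
  rewrite /ind /= /gapfun /room u01 !expr0 !mul1r !expr1 mulr1.
  rewrite (_ : (1 - u < t)%R); last by lra.
  rewrite mulr1; have -> : (1 - nextpt (X w) u < s)%R = (1 - s < nextpt (X w) u)%R by lra.
  have [H|H] := boolP (1 - s < nextpt (X w) u)%R; first by rewrite mem_set.
  by rewrite memNset //; apply/negP.
by rewrite integral_cst.
Qed.

End NextPointTail.

Section NextPointLaw.
Context d1 d2 (T1 : measurableType d1) (T2 : measurableType d2) (R : realType).
Context (P1 : probability T1 R) (P2 : probability T2 R).
Context (X1 : {RV P1 >-> hit_sets R}) (X2 : {RV P2 >-> hit_sets R}).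
Notation mu := (@lebesgue_measure R).
Local Open Scope ereal_scope.

Hypothesis gapE : forall a b, expected_gap X1 a b = expected_gap X2 a b.

Lemma room_moment_eq n : forall a b, room_moment X1 n a b = room_moment X2 n a b.
Proof.
elim: n => [|n IH] a b; first by rewrite !room_moment0.
by rewrite !room_momentS !IH.
Qed.

Lemma tail_integral_eq s t : tail_integral X1 s t = tail_integral X2 s t.
Proof.
have mX d (T : measurableType d) (P : probability T R) (X : {RV P >-> hit_sets R}) :
    measurable_fun setT (fun p : T * R => X p.1 : hit_sets R).
  by apply: measurableT_comp => //; exact: measurable_hit_rv.
have mgap d (T : measurableType d) (P : probability T R) (X : {RV P >-> hit_sets R}) a b :
    measurable_fun setT (fun p : T * R => gapfun a b (X p.1) p.2).
  by apply: measurable_gapfun => //; exact: mX.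
have mroom d (T : measurableType d) : measurable_fun setT (fun p : T * R => room p.2).
  by apply: measurableT_comp => //; exact: room_measurable.
have ri d (T : measurableType d) :
    measurable_fun setT (fun p : T * R => (room p.2 < t)%R%:R : R).
  rewrite (_ : (fun p => _) = (fun p : T * R => if (room p.2 < t)%R then 1%R else 0%R)).
    by apply: measurable_fun_ifT => //; apply: measurable_fun_ltr => //; exact: mroom.
  by apply/funext => p; case: ifP.
have gap01 d (T : measurableType d) (P : probability T R) (X : {RV P >-> hit_sets R}) a b (p : T * R) :
    (0 <= gapfun a b (X p.1) p.2 <= 1)%R.
  by rewrite gapfun_ge0 (le_trans (gapfun_le _ _ _ _)).
have fin d (T : measurableType d) (P : probability T R) (X : {RV P >-> hit_sets R}) b :
    \int[P \x mu]_p (gapfun 0 b (X p.1) p.2)%:E < +oo.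
  have := room_moment0 X 0 b; rewrite /room_moment.
  under eq_integral do rewrite expr0 mul1r.
  by move=> ->; rewrite -expected_gap_fin ltry.
(* The moments in [room p.2], then those in [gapfun 0 1 = 1 - nextpt]. *)
have A b : \int[P1 \x mu]_p ((room p.2 < t)%R%:R * gapfun 0 b (X1 p.1) p.2)%:E =
           \int[P2 \x mu]_p ((room p.2 < t)%R%:R * gapfun 0 b (X2 p.1) p.2)%:E.
  refine (@tail_moment_unique _ _ _ _ R (P1 \x mu) (P2 \x mu)
    (fun p => room p.2) (fun p => gapfun 0 b (X1 p.1) p.2)
    (fun p => room p.2) (fun p => gapfun 0 b (X2 p.1) p.2) t
    (mroom _ T1) (mgap _ _ _ X1 0%N b) (mroom _ T2) (mgap _ _ _ X2 0%N b) _ _ _ _ _ _).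
  - by move=> p; exact: room01.
  - by move=> p; exact: gapfun_ge0.
  - by move=> p; exact: room01.
  - by move=> p; exact: gapfun_ge0.
  - exact: fin.
  - by move=> n; exact: room_moment_eq.
apply: (@tail_moment_unique _ _ _ _ R (P1 \x mu) (P2 \x mu)
  (fun p => gapfun 0 1 (X1 p.1) p.2) (fun p => (room p.2 < t)%R%:R * gapfun 0 0 (X1 p.1) p.2)%R
  (fun p => gapfun 0 1 (X2 p.1) p.2) (fun p => (room p.2 < t)%R%:R * gapfun 0 0 (X2 p.1) p.2)%R
  s (mgap _ _ _ X1 0%N 1%N) _ (mgap _ _ _ X2 0%N 1%N)).
- by apply: measurable_funM; [exact: ri|exact: mgap].
- by apply: measurable_funM; [exact: ri|exact: mgap].
- by move=> p; exact: gap01.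
- by move=> p; rewrite mulr_ge0 // gapfun_ge0.
- by move=> p; exact: gap01.
- by move=> p; rewrite mulr_ge0 // gapfun_ge0.
- apply: le_lt_trans (fin _ _ _ X1 0%N); apply: ge0_le_integral => //.
  + by move=> p _; rewrite lee_fin mulr_ge0 // gapfun_ge0.
  + by apply/measurable_EFinP; apply: measurable_funM; [exact: ri|exact: mgap].
  + by apply/measurable_EFinP; exact: mgap.
  + move=> p _; rewrite lee_fin ler_piMl ?gapfun_ge0 //.
    by case: (_ < _)%R.
- move=> n.
  (* The [n]-th power of [gapfun 0 1] is [gapfun 0 n], so its moments are instances of [A]. *)
  have gn d (T : measurableType d) (P : probability T R) (X : {RV P >-> hit_sets R}) :
      (fun p : T * R => (gapfun 0 1 (X p.1) p.2 ^+ n *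
         ((room p.2 < t)%R%:R * gapfun 0 0 (X p.1) p.2))%:E) =
      (fun p => ((room p.2 < t)%R%:R * gapfun 0 n (X p.1) p.2)%:E).
    apply/funext => p; congr EFin; rewrite /gapfun; case: ifP => _; last by rewrite !mulr0.
    by rewrite !expr0 !mul1r expr1 mulr1 mulrC.
  by rewrite !gn.
Qed.

(** So far equality is known only after integration over [u]. The common average over []z, z']] lies
    between the values at the two ends, because the tails increase with [u]. *)
Lemma nextpt_tail_le y z z' : (0 <= z)%R -> (z < z')%R -> (z' < 1)%R ->
  nextpt_tail X1 y z <= nextpt_tail X2 y z'.
Proof.
move=> z0 zz' z'1.
have mono d (T : measurableType d) (P : probability T R) (X : {RV P >-> hit_sets R}) u v :
    (u <= v)%R -> (v < 1)%R -> nextpt_tail X y u <= nextpt_tail X y v.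
  move=> uv v1; rewrite /nextpt_tail le_measure ?inE //; try exact: measurable_nextpt_gt.
  by move=> w /= /lt_le_trans; apply; exact: nextpt_mono.
have split d (T : measurableType d) (P : probability T R) (X : {RV P >-> hit_sets R}) :
    \int[mu]_(u in `]z, 1%R[) nextpt_tail X y u =
    \int[mu]_(u in `]z, z']) nextpt_tail X y u + \int[mu]_(u in `]z', 1%R[) nextpt_tail X y u.
  rewrite -ge0_integral_setU //.
  - rewrite -itv_bndbnd_setU ?bnd_simp //; exact: ltW.
  - by apply: measurable_funTS; exact: measurable_nextpt_tail.
  - apply/disj_setPS => u []; rewrite /= !in_itv /= => /andP[_ uz] /andP[zu _].
    by move: uz; rewrite leNgt zu.
have tailE s : (0 <= s)%R -> \int[mu]_(u in `]s, 1%R[) nextpt_tail X1 y u =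
    \int[mu]_(u in `]s, 1%R[) nextpt_tail X2 y u.
  move=> s0; have s1 : (1 - s <= 1)%R by lra.
  have := tail_integral_eq (1 - y)%R (1 - s)%R; rewrite !tail_integralE //.
  have sub1K (r : R) : (1 - (1 - r) = r)%R by lra.
  by rewrite !sub1K.
have fin d (T : measurableType d) (P : probability T R) (X : {RV P >-> hit_sets R}) s :
    \int[mu]_(u in `]s, 1%R[) nextpt_tail X y u \is a fin_num.
  rewrite ge0_fin_numE; last by apply: integral_ge0.
  apply: (@le_lt_trans _ _ (\int[mu]_(u in `]s, 1%R[) cst 1 u)); last first.
    by rewrite integral_cst // mul1e [X in X < _]lebesgue_measure_itv /=; case: ifP => _; rewrite -?EFinB ltry.
  apply: ge0_le_integral => //.
  - by apply: measurable_funTS; exact: measurable_nextpt_tail.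
  - by move=> u _; apply: probability_le1; exact: measurable_nextpt_gt.
have E : \int[mu]_(u in `]z, z']) nextpt_tail X1 y u = \int[mu]_(u in `]z, z']) nextpt_tail X2 y u.
  have := tailE z z0; rewrite !split (tailE z') ?(le_trans z0 (ltW zz')) //.
  move=> /(congr1 (fun e => e - \int[mu]_(u in `]z', 1%R[) nextpt_tail X2 y u)).
  by rewrite !addeK.
have len : mu `]z, z'] = (z' - z)%:E by rewrite [LHS]lebesgue_measure_itv /= lte_fin zz' EFinB.
have z'z : (0 < z' - z)%R by rewrite subr_gt0.
rewrite -(@lee_pmul2r _ (z' - z)%:E) //.
apply: (@le_trans _ _ (\int[mu]_(u in `]z, z']) nextpt_tail X1 y u)).
  rewrite -len -(integral_cst mu) //; apply: ge0_le_integral => //.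
  - by apply: measurable_funTS; exact: measurable_nextpt_tail.
  - move=> u; rewrite /= in_itv /= => /andP[zu uz'].
    by apply: mono; [exact: ltW|exact: le_lt_trans uz' z'1].
rewrite E -len -(integral_cst mu) //; apply: ge0_le_integral => //.
- by apply: measurable_funTS; exact: measurable_nextpt_tail.
- by move=> u; rewrite /= in_itv /= => /andP[zu uz']; exact: mono.
Qed.

End NextPointLaw.

(** Start and threshold tend to [z] from above and to [s] from below together; by right continuity
    the strict events decrease to the closed one. The hypothesis is symmetric, so one inequality
    suffices. *)
Lemma nextpt_ge_le d1 d2 (T1 : measurableType d1) (T2 : measurableType d2) (R : realType)
    (P1 : probability T1 R) (P2 : probability T2 R)
    (X1 : {RV P1 >-> hit_sets R}) (X2 : {RV P2 >-> hit_sets R}) (z s : R) :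
  (forall a b, expected_gap X1 a b = expected_gap X2 a b) -> 0 <= z < 1 ->
  (P1 [set w | (s <= nextpt (X1 w) z)%R] <= P2 [set w | (s <= nextpt (X2 w) z)%R])%E.
Proof.
move=> gapE /andP[z0 z1].
(* The denominator [n.+2] keeps [zn 0] below 1. *)
pose zn (n : nat) := z + (1 - z) / n.+2%:R; pose sn (n : nat) := s - n.+1%:R^-1.
have zn1 n : zn n < 1.
  by rewrite /zn -ltrBrDl ltr_pdivrMr // ltr_pMr ?subr_gt0 // ltr1n.
have zzn n : z < zn n by rewrite ltrDl divr_gt0 // subr_gt0.
have zn0 : zn @ \oo --> z.
  rewrite -[X in _ --> X]addr0 /zn; apply: cvgD; first exact: cvg_cst.
  rewrite -[X in _ --> X](mulr0 (1 - z)); apply: cvgM; first exact: cvg_cst.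
  have := @cvg_harmonic R; rewrite -(cvg_shiftn 1) /=; apply: cvg_trans.
  by apply: near_eq_cvg; apply: nearW => n; rewrite addn1.
pose F n := [set w | sn n < nextpt (X2 w) (zn n)].
have FE : \bigcap_n F n = [set w | s <= nextpt (X2 w) z].
  apply/seteqP; split => w; last first.
    move=> /= sz n _; rewrite /F /=; apply: lt_le_trans (_ : s <= _).
      by rewrite /sn ltrBlDr ltrDl.
    by apply: le_trans sz _; apply: nextpt_mono => //; exact: ltW.
  move=> H; rewrite /= leNgt; apply/negP => /(nextpt_ltP _ _ z1)[x [Ax /andP[zx x1] xs]].
  have near1 : \forall n \near \oo, zn n < x by apply: (cvgr_lt z).
  have near2 : \forall n \near \oo, x <= sn n.
    have sn0 : sn @ \oo --> s.
      rewrite -[X in _ --> X]subr0; apply: cvgB; [exact: cvg_cst|exact: cvg_harmonic].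
    by apply: (cvgr_ge s).
  have [n [znx xsn]] : exists n, zn n < x /\ x <= sn n.
    have : \forall n \near \oo, zn n < x /\ x <= sn n by near=> n; split; near: n.
    by move=> [N _ /(_ N (leqnn N))] H'; exists N.
  have := H n I; rewrite /F /= ltNge => /negP; apply.
  by apply: le_trans xsn; apply: nextpt_le => //; rewrite znx.
have mF n : measurable (F n) by exact: measurable_nextpt_gt.
have cF : P2 (F n) @[n --> \oo] --> P2 (\bigcap_n F n).
  apply: nonincreasing_cvg_mu => //.
  - by apply: le_lt_trans (ltry 1); apply: probability_le1.
  - exact: bigcapT_measurable.
  - move=> n m nm; apply/subsetPset => w; rewrite /F /= => H.
    apply: le_lt_trans (lt_le_trans H _).
      by rewrite /sn lerD2l lerN2 lef_pV2 ?posrE // ler_nat.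
    apply: nextpt_mono => //; rewrite /zn lerD2l ler_wpM2l ?subr_ge0 ?(ltW z1) //.
    by rewrite lef_pV2 ?posrE // ler_nat.
rewrite -FE -(cvg_lim _ cF) //; apply: lime_ge; first by apply/cvg_ex; eexists; exact: cF.
apply: nearW => n.
apply: le_trans (nextpt_tail_le gapE (sn n) z0 (zzn n) (zn1 n)).
rewrite /nextpt_tail le_measure ?inE //; last 2 first.
- exact: measurable_nextpt_gt.
- by move=> w /=; apply: lt_le_trans; rewrite /sn ltrBlDr ltrDl.
rewrite (_ : [set _ | _] = ~` [set w | nextpt (X1 w) z < s]); last first.
  by apply/seteqP; split => w /=; rewrite leNgt => /negP.
apply: measurableC; rewrite -[X in measurable X]setTI.
have mn : measurable_fun setT (fun w => nextpt (X1 w) z).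
  by apply: measurable_nextpt_comp; exact: measurable_cst.
have m1 : measurable_fun setT (fun _ : T1 => s) by exact: measurable_cst.
exact: (measurable_fun_ltr mn m1 measurableT (Y := [set true])).
Unshelve. all: by end_near. Qed.

(** * The law of a regenerative set *)

Lemma measurable_inv (R : realType) : measurable_fun setT (@GRing.inv R).
Proof.
have m0 : measurable [set 0 : R] by exact: measurable_set1.
rewrite -(setvU [set 0 : R]); apply/measurable_funU => //; first exact: measurableC.
split; last exact: measurable_fun_set1.
apply: open_continuous_measurable_fun.
  by apply: closed_openC; apply: accessible_closed_set1; exact: hausdorff_accessible.
by move=> x; rewrite inE /= => /eqP; exact: inv_continuous.
Qed.

Section Avoidance.
Variable R : realType.
Implicit Types (l : seq (R * R)) (A : set R) (q : R * R).

(** When [A] is closed, contains 0 and 1, and [0 <= p.1 < 1], the condition at [p] says that [A]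
    misses []p.1, p.2[]. *)
Definition reaches l A : bool := all (fun p => p.2 <= nextpt A p.1) l.

Definition rescale_constraint (x : R) (q : R * R) : R * R :=
  ((q.1 - x) / (1 - x), (q.2 - x) / (1 - x)).

(** The event [reaches (q0 :: l)] in terms of the next point [x] of [q0.1] and the rescaled set: a
    constraint starting before [x] sees only [x], the others are rescaled. Keeping the two arguments
    apart prepares the use of independence. *)
Definition reaches_beyond (q0 : R * R) l (x : R) A : bool :=
  (q0.2 <= x) && all (fun q : R * R => if q.1 < x then q.2 <= x else
     (q.2 - x) / (1 - x) <= nextpt A ((q.1 - x) / (1 - x))) l.

Lemma reaches_rescaled A (q0 : R * R) l : is_closed01 A -> 0 <= q0.1 < 1 ->
  all (fun q => q0.1 <= q.1 < 1) l -> nextpt A q0.1 < 1 ->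
  reaches (q0 :: l) A = reaches_beyond q0 l (nextpt A q0.1) (rescaled A q0.1).
Proof.
move=> A01 /andP[a0 a1] /allP Hl D1; rewrite /reaches /reaches_beyond /=; congr (_ && _).
set D := nextpt A q0.1 in D1 *; have D0 : 0 < 1 - D by rewrite subr_gt0.
apply: eq_in_all => q /Hl /andP[aq q1]; case: ltP => [qD|Dq].
  by rewrite (nextpt_gap aq qD).
have x01 : 0 <= (q.1 - D) / (1 - D) < 1.
  by rewrite divr_ge0 ?subr_ge0 ?(ltW D1) //= ltr_pdivrMr // mul1r ltrD2r.
have := nextpt_rescaled A01 a1 D1 x01; rewrite -/D.
have -> : D + (1 - D) * ((q.1 - D) / (1 - D)) = q.1.
  by rewrite mulrCA mulfV ?gt_eqF // mulr1 addrC subrK.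
by move=> ->; rewrite ler_pdivrMr // lerBlDl [_ * (1 - D)]mulrC.
Qed.

Lemma reaches_end A (q0 : R * R) l : is_closed01 A -> 0 <= q0.1 < 1 ->
  all (fun q => q0.1 <= q.1 < 1) l -> ~~ (nextpt A q0.1 < 1) ->
  reaches (q0 :: l) A = all (fun q => q.2 <= 1) (q0 :: l).
Proof.
move=> A01 /andP[a0 a1] /allP Hl D1.
have DE : nextpt A q0.1 = 1 by apply: le_anti; rewrite nextpt_le1 // leNgt.
rewrite /reaches /= DE; congr (_ && _); apply: eq_in_all => q /Hl /andP[aq q1].
by rewrite (@nextpt_gap _ A q0.1) // DE.
Qed.

(** For fixed [x] this is again a [reaches] event, with at most [size l] constraints, which makes an
    induction on the number of constraints possible. *)
Lemma reaches_beyond_fixed (q0 : R * R) l (x : R) A :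
  reaches_beyond q0 l x A =
  [&& q0.2 <= x, all (fun q => (q.1 < x) ==> (q.2 <= x)) l &
   reaches [seq rescale_constraint x q | q <- l & x <= q.1] A].
Proof.
rewrite /reaches_beyond /reaches all_map; congr (_ && _).
elim: l => [//|q l IH] /=; rewrite IH; case: (leP x q.1) => xq /=.
  by rewrite andbCA.
by rewrite andbA.
Qed.

Lemma measurable_reaches_beyond (q0 : R * R) l :
  measurable_fun setT (fun p : R * hit_sets R => reaches_beyond q0 l p.1 p.2).
Proof.
apply: measurable_and; first by apply: measurable_fun_ler => //; exact: measurable_cst.
elim: l => [|q l IH] /=; first exact: measurable_cst.
apply: measurable_and => //; apply: measurable_fun_ifT.
- by apply: measurable_fun_ltr => //; exact: measurable_cst.
- by apply: measurable_fun_ler => //; exact: measurable_cst.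
have mdiv (c : R) : measurable_fun setT (fun p : R * hit_sets R => (c - p.1) / (1 - p.1)).
  apply: measurable_funM; first exact: measurable_funB.
  by apply: (measurableT_comp (@measurable_inv R)); exact: measurable_funB.
apply: measurable_fun_ler => //.
apply: (measurableT_comp (f := fun p : R * hit_sets R => nextpt p.2 p.1)
  (g := fun p : R * hit_sets R => ((q.1 - p.1) / (1 - p.1), p.2))); first exact: nextpt_measurable.
exact: measurable_fun_pair.
Qed.

End Avoidance.

Section ReachLaw.
Context d1 d2 (T1 : measurableType d1) (T2 : measurableType d2) (R : realType).
Context (P1 : probability T1 R) (P2 : probability T2 R).
Context (X1 : {RV P1 >-> hit_sets R}) (X2 : {RV P2 >-> hit_sets R}).
Hypothesis r1 : multiplicatively_regenerative X1.
Hypothesis r2 : multiplicatively_regenerative X2.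
Hypothesis gapE : forall a b, expected_gap X1 a b = expected_gap X2 a b.
Local Open Scope ereal_scope.

Let mnext d (T : measurableType d) (P : probability T R) (X : {RV P >-> hit_sets R}) (z : R) :
  measurable_fun setT (fun w => nextpt (X w) z).
Proof. by apply: measurable_nextpt_comp; exact: measurable_cst. Qed.

Lemma nextpt_law (z : R) (B : set R) : (0 <= z < 1)%R -> measurable B ->
  P1 [set w | B (nextpt (X1 w) z)] = P2 [set w | B (nextpt (X2 w) z)].
Proof.
move=> z01 mB.
pose D1 : {mfun T1 >-> R} := HB.pack (fun w => nextpt (X1 w) z) (isMeasurableFun.Build _ _ _ _ _ (mnext X1 z)).
pose D2 : {mfun T2 >-> R} := HB.pack (fun w => nextpt (X2 w) z) (isMeasurableFun.Build _ _ _ _ _ (mnext X2 z)).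
change (distribution P1 D1 B = distribution P2 D2 B).
refine (@measure_unique _ R R (@measurable_realfun.RGenCInfty.G R)
  (fun n : nat => `[(- n%:R)%R, +oo[%classic) _ _ _ _ (distribution P1 D1) (distribution P2 D2) _ _ _ mB).
- exact: measurable_realfun.RGenCInfty.measurableE.
- move=> _ _ [x ->] [y ->]; exists (Num.max x y).
  by apply/seteqP; split => u; rewrite /= !in_itv /= !andbT ge_max;
    [by move=> [-> ->]|by move=> /andP[-> ->]].
- by move=> n; exists (- n%:R)%R.
- rewrite -subTset => x _; exists (Num.truncn `|x|).+1 => //.
  rewrite /= in_itv /= andbT lerNl (le_trans (ler_norm _)) // normrN.
  exact/ltW/truncnS_gt.
- move=> _ [s ->].
  have itvE d (T : measurableType d) (P : probability T R) (X : {RV P >-> hit_sets R}) :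
      (fun w => nextpt (X w) z) @^-1` `[s, +oo[%classic = [set w | (s <= nextpt (X w) z)%R].
    by apply/seteqP; split => w; rewrite /= in_itv /= andbT.
  change (P1 ((fun w => nextpt (X1 w) z) @^-1` `[s, +oo[%classic) =
    P2 ((fun w => nextpt (X2 w) z) @^-1` `[s, +oo[%classic)).
  rewrite !itvE.
  by apply/eqP; rewrite eq_le; apply/andP; split; apply: nextpt_ge_le => // a b; rewrite gapE.
- by move=> n; apply: le_lt_trans (ltry 1); exact: probability_le1.
Qed.


Let boolE d (T : measurableType d) (P : probability T R) (c : T -> bool) :
  measurable_fun setT c -> P [set w | c w] = \int[P]_w (c w)%:R%:E.
Proof.
move=> mc; have mS : measurable [set w | c w].
  by rewrite -[X in measurable X]setTI; exact: (mc measurableT [set true]).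
rewrite -[in LHS](setIT [set w | c w]) -(integral_indic P measurableT mS).
apply: eq_integral => w _; rewrite indicE; congr (_%:R%:E).
by case: (boolP (c w)) => H; [rewrite mem_set|rewrite memNset //; apply/negP].
Qed.

Lemma measurable_reaches d (T : measurableType d) (P : probability T R)
    (X : {RV P >-> hit_sets R}) l : measurable_fun setT (fun w => reaches l (X w)).
Proof.
elim: l => [|q l IH] /=; first exact: measurable_cst.
by apply: measurable_and => //; apply: measurable_fun_ler => //; exact: mnext.
Qed.

Let mbeyond q0 l :
  measurable_fun setT (fun p : R * hit_sets R => (reaches_beyond q0 l p.1 p.2)%:R%:E : \bar R).
Proof.
apply/measurable_EFinP; rewrite (_ : (fun p => _) =
    (fun p : R * hit_sets R => if reaches_beyond q0 l p.1 p.2 then 1%R else 0%R)).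
  by apply: measurable_fun_ifT => //; exact: measurable_reaches_beyond.
by apply/funext => p; case: ifP.
Qed.

Let beyond_prob d (T : measurableType d) (P : probability T R) (X : {RV P >-> hit_sets R}) q0 l x :=
  \int[P]_w (reaches_beyond q0 l x (X w))%:R%:E.

Let mE d (T : measurableType d) (P : probability T R) (X : {RV P >-> hit_sets R}) z :
  measurable [set w | (nextpt (X w) z < 1)%R].
Proof.
rewrite -[X in measurable X]setTI.
exact: (measurable_fun_ltr (mnext X z) (measurable_cst (1%R : R)) measurableT (Y := [set true])).
Qed.

(** Regeneration at the first start handles the event that its next point is below 1. Otherwise all
    later starts also have next point 1, and the condition is deterministic. *)
Let first_step d (T : measurableType d) (P : probability T R) (X : {RV P >-> hit_sets R}) q0 l :
  multiplicatively_regenerative X -> (0 <= q0.1 < 1)%R ->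
  all (fun q => q0.1 <= q.1 < 1)%R l ->
  P [set w | reaches (q0 :: l) (X w)] =
  \int[P]_(w in [set w | (nextpt (X w) q0.1 < 1)%R]) beyond_prob X q0 l (nextpt (X w) q0.1) +
  (all (fun q => q.2 <= 1)%R (q0 :: l))%:R%:E * P [set w | ~~ (nextpt (X w) q0.1 < 1)%R].
Proof.
move=> Xr q01 Hl; have X01 w : is_closed01 (X w) by case: Xr => /(_ w).
set E := [set w | (nextpt (X w) q0.1 < 1)%R]; have mEE : measurable E by exact: mE.
have mrl := measurable_reaches X (q0 :: l).
have mrl' : measurable_fun setT (fun w => (reaches (q0 :: l) (X w))%:R%:E : \bar R).
  apply/measurable_EFinP; rewrite (_ : (fun p => _) =
    (fun w => if reaches (q0 :: l) (X w) then 1%R else 0%R)).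
    exact: measurable_fun_ifT.
  by apply/funext => p; case: ifP.
rewrite boolE // -(setvU E) ge0_integral_setU //; last 3 first.
- exact: measurableC.
- by rewrite setvU.
- by apply/disj_setPS; rewrite setICl.
rewrite addeC; congr (_ + _).
  transitivity (\int[P]_(w in E)
     (reaches_beyond q0 l (nextpt (X w) q0.1) (future_set X q0.1 w))%:R%:E).
    apply: eq_integral => w; rewrite inE => Dw.
    by rewrite reaches_rescaled // /future_set ifT.
  apply: (@regen_integral _ _ _ _ X X01 q0.1 q01 Xr
    (fun p => (reaches_beyond q0 l p.1 p.2)%:R%:E)) => //.
rewrite (_ : [set w | ~~ _] = ~` E); last by apply/seteqP; split => w /negP.
rewrite -(integral_cst P); last exact: measurableC.
by apply: eq_integral => w; rewrite inE => /negP Dw; rewrite reaches_end.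
Qed.

(** The next point of the leftmost start has the same law for both sets, and for each of its values
    the remaining constraints fall under the induction hypothesis. A bound on the length is used
    because the number of constraints passed at once varies. *)
Lemma reaches_law (k : nat) (l : seq (R * R)) : (size l <= k)%N ->
  sorted (fun p q : R * R => p.1 <= q.1)%R l -> all (fun q => 0 <= q.1 < 1)%R l ->
  P1 [set w | reaches l (X1 w)] = P2 [set w | reaches l (X2 w)].
Proof.
have nilE d (T : measurableType d) (P : probability T R) (X : {RV P >-> hit_sets R}) :
    P [set w | reaches [::] (X w)] = 1.
  by rewrite -(probability_setT P); congr (P _); apply/seteqP; split.
elim: k l => [|k IH] [|q0 l] lk; rewrite ?nilE //.
move=> sl /andP[q01 /allP l01].
have tr : transitive (fun p q : R * R => p.1 <= q.1)%R by move=> ? ? ?; exact: le_trans.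
have /allP Hl := order_path_min tr sl.
have al : all (fun q => q0.1 <= q.1 < 1)%R l.
  by apply/allP => q ql; rewrite Hl //; case/andP: (l01 q ql).
rewrite !first_step //.
have law B := @nextpt_law q0.1 B q01.
congr (_ + _ * _); last first.
  have := law [set x | ~~ (x < 1)%R]; apply.
  rewrite (_ : [set _ | _] = `[1%R, +oo[%classic) //.
  by apply/seteqP; split => x; rewrite /= in_itv /= andbT leNgt.
have beyondE x : (x < 1)%R -> beyond_prob X1 q0 l x = beyond_prob X2 q0 l x.
  move=> x1; rewrite /beyond_prob -!boolE; last 2 first.
  - by apply: (measurableT_comp (measurable_reaches_beyond q0 l)
      (g := fun w => (x, X2 w))); apply: measurable_fun_pair => //; exact: measurable_hit_rv.
  - by apply: (measurableT_comp (measurable_reaches_beyond q0 l)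
      (g := fun w => (x, X1 w))); apply: measurable_fun_pair => //; exact: measurable_hit_rv.
  under eq_set do rewrite reaches_beyond_fixed.
  under [in RHS]eq_set do rewrite reaches_beyond_fixed.
  have falseE d (T : measurableType d) (P : probability T R) : P [set w | false] = 0.
    by rewrite -(measure0 P); congr (P _); apply/seteqP; split.
  case: (q0.2 <= x)%R; last by rewrite /= !falseE.
  case: (all _ l); last by rewrite /= !falseE.
  apply: IH.
  - by rewrite size_map size_filter (leq_trans (count_size _ _)).
  - rewrite sorted_map; apply: (sub_sorted (e := fun p q : R * R => p.1 <= q.1)%R).
      move=> p q /= pq; rewrite ler_wpM2r ?lerD2r // invr_ge0 subr_ge0; exact: ltW.
    by apply: sorted_filter => //; exact: path_sorted sl.
  - apply/allP => _ /mapP[q + ->]; rewrite mem_filter => /andP[xq ql] /=.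
    have /andP[_ q1] := l01 q ql.
    by rewrite divr_ge0 ?subr_ge0 ?(ltW x1) //= ltr_pdivrMr ?subr_gt0 // mul1r ltrD2r.
pose D1 : {mfun T1 >-> R} := HB.pack (fun w => nextpt (X1 w) q0.1) (isMeasurableFun.Build _ _ _ _ _ (mnext X1 q0.1)).
pose D2 : {mfun T2 >-> R} := HB.pack (fun w => nextpt (X2 w) q0.1) (isMeasurableFun.Build _ _ _ _ _ (mnext X2 q0.1)).
have itvE d (T : measurableType d) (P : probability T R) (X : {RV P >-> hit_sets R}) :
    [set w | (nextpt (X w) q0.1 < 1)%R] = (fun w => nextpt (X w) q0.1) @^-1` `]-oo, 1%R[%classic.
  by apply/seteqP; split => w; rewrite /= in_itv.
have mphi d (T : measurableType d) (P : probability T R) (X : {RV P >-> hit_sets R}) :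
    measurable_fun setT (beyond_prob X q0 l).
  apply: (@measurable_fun_fubini_tonelli_F _ _ _ _ _ P
    (fun p : R * T => (reaches_beyond q0 l p.1 (X p.2))%:R%:E)).
    apply: (measurableT_comp (mbeyond q0 l) (g := fun p : R * T => (p.1, X p.2))).
    by apply: measurable_fun_pair => //; apply: measurableT_comp => //; exact: measurable_hit_rv.
  by move=> p; rewrite lee_fin.
have phi0 d (T : measurableType d) (P : probability T R) (X : {RV P >-> hit_sets R}) x :
    0 <= beyond_prob X q0 l x by apply: integral_ge0 => w _; rewrite lee_fin.
rewrite !itvE.
transitivity (\int[distribution P1 D1]_(x in `]-oo, 1%R[) beyond_prob X1 q0 l x).
  by rewrite ge0_integral_pushforward //; exact: measurable_funTS.
transitivity (\int[distribution P2 D2]_(x in `]-oo, 1%R[) beyond_prob X2 q0 l x); last first.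
  by rewrite ge0_integral_pushforward //; exact: measurable_funTS.
transitivity (\int[distribution P1 D1]_(x in `]-oo, 1%R[) beyond_prob X2 q0 l x).
  by apply: eq_integral => x; rewrite inE /= in_itv /=; exact: beyondE.
by apply: eq_measure_integral => A mA _; exact: law.
Qed.

End ReachLaw.

(** * Avoidance events as a generator stable under intersection *)

Section AvoidedIntervals.
Variable R : realType.

Definition avoiding (l : seq (R * R)) : set (set R) :=
  [set A | forall p, p \in l -> ~ (A `&` `]p.1, p.2[ !=set0)].

Definition avoidance_events : set (set (set R)) := [set B | exists l, B = avoiding l].

Lemma measurable_avoidance_events : @measurable _ (hit_sets R) = <<s avoidance_events >>.
Proof.
apply/seteqP; split; last first.
  apply: smallest_sub; first exact: sigma_algebra_measurable.
  move=> _ [l ->]; elim: l => [|p l IH].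
    rewrite (_ : avoiding [::] = setT); first exact: (@measurableT _ (hit_sets R)).
    by apply/seteqP; split.
  rewrite (_ : avoiding (p :: l) = ~` [set A | A `&` `]p.1, p.2[ !=set0] `&` avoiding l).
    by apply: (@measurableI _ (hit_sets R)) => //;
      apply: (@measurableC _ (hit_sets R)); apply: measurable_hit; exact: itv_open.
  apply/seteqP; split => A /= => [H|[H1 H2] q]; last by rewrite inE => /orP[/eqP ->|/H2].
  by split; [apply: H; rewrite mem_head|move=> q ql; apply: H; rewrite inE ql orbT].
have mid : measurable_fun setT (id : g_sigma_algebraType avoidance_events -> hit_sets R).
  apply: hit_measurable_fun => a b.
  rewrite (_ : [set _ | _] = ~` avoiding [:: (a, b)]).
    by apply: measurableC; apply: sub_sigma_algebra; exists [:: (a, b)].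
  apply/seteqP; split => A /= => [H /(_ (a, b) (mem_head _ _))//|H].
  by apply: contrapT => nH; apply: H => p; rewrite inE => /eqP ->.
move=> B mB; have := mid measurableT B mB; rewrite setTI; exact.
Qed.

Lemma avoidance_events_setI : setI_closed avoidance_events.
Proof.
move=> _ _ [l ->] [l' ->]; exists (l ++ l'); apply/seteqP; split => A.
  by move=> [H H'] p; rewrite mem_cat => /orP[/H|/H'].
by move=> H; split => p pl; apply: H; rewrite mem_cat pl ?orbT.
Qed.

(** An interval around 0 is always hit, which gives [c = false]; one disjoint from [0, 1] is always
    missed and is dropped; the others start in [[0, 1[]. *)
Lemma avoiding_reaches (l : seq (R * R)) : exists (c : bool) (l' : seq (R * R)),
  all (fun q => 0 <= q.1 < 1) l' /\
  forall A, is_closed01 A -> avoiding l A <-> c && reaches l' A.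
Proof.
elim: l => [|[a b] l [c [l' [al' H]]]].
  by exists true, [::]; split.
have consE A : avoiding ((a, b) :: l) A <-> ~ (A `&` `]a, b[ !=set0) /\ avoiding l A.
  split => [H'|[H1 H2] q]; last by rewrite inE => /orP[/eqP ->|/H2].
  by split; [apply: (H' (a, b)); rewrite mem_head|move=> q ql; apply: H'; rewrite inE ql orbT].
have [ab|ab] := boolP (a < 0 < b).
  exists false, [::]; split => // A A01; split => // /consE[nh _].
  by exfalso; apply: nh; apply/closed01_hit => //; left.
have [a01|a01] := boolP (0 <= a < 1); last first.
  exists c, l'; split => // A A01; rewrite consE -H //; split => [[]//|?]; split => //.
  by move=> /(closed01_hit _ _ A01)[H'|[H' _]]; [rewrite H' in ab|rewrite H' in a01].
exists c, ((a, b) :: l'); split; first by rewrite /= a01.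
move=> A A01; rewrite consE H // /reaches /=; split.
  move=> [nh /andP[-> ->]]; rewrite andbT /= leNgt; apply/negP => nb.
  by apply: nh; apply/closed01_hit => //; right.
move=> /and3P[-> ba ->]; split => //.
move=> /(closed01_hit _ _ A01)[H'|[_]]; first by rewrite H' in ab.
by rewrite ltNge ba.
Qed.

End AvoidedIntervals.

Lemma regenerative_set_law d1 d2 (T1 : measurableType d1) (T2 : measurableType d2)
    (R : realType) (P1 : probability T1 R) (P2 : probability T2 R)
    (X1 : {RV P1 >-> hit_sets R}) (X2 : {RV P2 >-> hit_sets R}) :
  multiplicatively_regenerative X1 -> multiplicatively_regenerative X2 ->
  (forall n, (0 < n)%N -> expected_gap X1 n 0 = expected_gap X2 n 0) ->
  same_law X1 X2.
Proof.
move=> r1 r2 gap0 B mB; have gapE := expected_gap_unique r1 r2 gap0.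
have [[c1 _] [c2 _]] := (r1, r2).
refine (@measure_unique _ R (hit_sets R) (@avoidance_events R) (fun=> setT)
  _ _ _ _ (distribution P1 X1) (distribution P2 X2) _ _ B mB).
- exact: measurable_avoidance_events.
- exact: avoidance_events_setI.
- by move=> _; exists [::]; apply/seteqP; split.
- by apply/seteqP; split => // A _; exists 0%N.
- move=> _ [l ->]; have [c [l' [al' H]]] := avoiding_reaches l.
  pose le1 (p q : R * R) := p.1 <= q.1.
  have sE A : reaches l' A = reaches (sort le1 l') A.
    by rewrite /reaches; apply/esym/perm_all; rewrite perm_sort.
  have HE d (T : measurableType d) (P : probability T R) (X : {RV P >-> hit_sets R}) :
      (forall w, is_closed01 (X w)) ->
      X @^-1` avoiding l = [set w | c && reaches (sort le1 l') (X w)].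
    by move=> X01; apply/seteqP; split => w; rewrite /= -sE => /(H _ (X01 w)).
  change (P1 (X1 @^-1` avoiding l) = P2 (X2 @^-1` avoiding l)).
  rewrite !HE //; case: c {H HE}; last first.
    have falseE d (T : measurableType d) (P : probability T R) : P [set w | false] = 0%E.
      by rewrite -(measure0 P); congr (P _); apply/seteqP; split.
    by rewrite !falseE.
  apply: (reaches_law r1 r2 gapE (leqnn _)).
    by apply: sort_sorted => p q; exact: le_total.
  by rewrite (perm_all _ (permEl (perm_sort _ _))).
- by move=> _; apply: le_lt_trans (ltry 1); exact: (@probability_le1 _ _ _ (distribution P1 X1)).
Qed.

Theorem corollary7p3 (R : realType) :
  (* laws of infinite exchangeable partitions *)
  (forall (d d1 d2 : measure_display) (T : measurableType d)
     (T1 : measurableType d1) (T2 : measurableType d2)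
     (P : probability T R) (P1 : probability T1 R) (P2 : probability T2 R)
     (Pi : {RV P >-> partitions})
     (C1 : {RV P1 >-> comp_seqs}) (C2 : {RV P2 >-> comp_seqs}),
     exchangeable_partition Pi ->
     regenerative_composition_structure C1 ->
     regenerative_composition_structure C2 ->
     corresponds Pi C1 -> corresponds Pi C2 ->
     same_law C1 C2) /\
  (* the same, with the law of the partition identified with a partition
     structure *)
  (forall (d1 d2 : measure_display)
     (T1 : measurableType d1) (T2 : measurableType d2)
     (P1 : probability T1 R) (P2 : probability T2 R)
     (C1 : {RV P1 >-> comp_seqs}) (C2 : {RV P2 >-> comp_seqs}),
     regenerative_composition_structure C1 ->
     regenerative_composition_structure C2 ->
     same_partition_structure C1 C2 ->
     same_law C1 C2) /\
  (* laws of ranked lengths *)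
  (forall (d d1 d2 : measure_display) (T : measurableType d)
     (T1 : measurableType d1) (T2 : measurableType d2)
     (P : probability T R) (P1 : probability T1 R) (P2 : probability T2 R)
     (Y : {RV P >-> real_seqs R})
     (X1 : {RV P1 >-> hit_sets R}) (X2 : {RV P2 >-> hit_sets R}),
     (forall w, [/\ forall j, 0 <= Y w j,
                    forall i j, (i <= j)%N -> Y w j <= Y w i
                  & (\sum_(0 <= j <oo) (Y w j)%:E <= 1)%E]) ->
     multiplicatively_regenerative X1 ->
     multiplicatively_regenerative X2 ->
     ranked_lengths_distributed_like X1 Y ->
     ranked_lengths_distributed_like X2 Y ->
     same_law X1 X2).
Proof.
split; [|split].
- move=> d d1 d2 T T1 T2 P P1 P2 Pi C1 C2 _; exact: corresponds_law.
- move=> d1 d2 T1 T2 P1 P2 C1 C2; exact: same_partition_structure_law.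
move=> d d1 d2 T T1 T2 P P1 P2 Y X1 X2 _ r1 r2 Y1 Y2.
apply: regenerative_set_law => // n n0.
have [[c1 _] [c2 _]] := (r1, r2).
have := expected_gap_ranked_lengths c1 Y1 n0.
rewrite -(expected_gap_ranked_lengths c2 Y2 n0).
rewrite -(expected_gap_fin X1) -(expected_gap_fin X2) -!EFinM => E.
by congr EFin; apply: mulfI (EFin_inj E); rewrite pnatr_eq0.
Qed.
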